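(* Let $d\ge1$, $\lambda>0$, $x\in[0,1]^d$, and let $\mathcal V(x)$ be the hyper-rectangle containing $x$ in the partition of $[0,1]^d$ given by the pruned Mondrian process $MP(\lambda)$. For every $\delta\in(0,1-(1-e^{-1})^d]$, with probability at least $1-2\delta$, $$\frac{h_+(\mathcal V(x))}{h_-(\mathcal V(x))}\ \le\ \frac{5d\log(\delta/d)}{\log(1-\delta)}.$$
   Context: For a hyper-rectangle $A$, $h_-(A)$ and $h_+(A)$ denote its smallest and largest side lengths. Pruned Mondrian process $MP(\lambda)$ with lifetime $\lambda>0$ on $[0,1]^d$: the random partition built recursively as follows, starting from the cell $[0,1]^d$ with birth time $0$. Given a cell $A=\prod_{j=1}^d[a_j,b_j]$ with birth time $\tau$, draw an exponential variable $E$ with rate $\sum_{j=1}^d(b_j-a_j)$. If $\tau+E>\lambda$, the cell $A$ is kept as a cell (leaf) of the final partition. Otherwise, choose a coordinate $j$ with probability proportional to $b_j-a_j$, choose a split location uniformly on $[a_j,b_j]$, cut $A$ at this location perpendicularly to coordinate $j$, and apply the same procedure independently to the two resulting cells, with birth time $\tau+E$. All random draws are independent given the past. *)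

(* Defs.v *)
(* MathComp-Analysis *)
From HB Require Import structures.
From mathcomp Require Export all_boot all_order all_algebra.
From mathcomp Require Export all_classical all_reals all_analysis.
Set Implicit Arguments.
Unset Strict Implicit.
Unset Printing Implicit Defensive.
Import Order.TTheory GRing.Theory Num.Theory.
Import numFieldNormedType.Exports.
Local Open Scope classical_set_scope.
Local Open Scope ring_scope.

Record box (R : realType) (d : nat) := Box { lo : 'rV[R]_d ; hi : 'rV[R]_d }.

Definition in_box (R : realType) (d : nat) (x : 'rV[R]_d) (A : box R d) : Prop :=
  forall j, lo A 0 j <= x 0 j <= hi A 0 j.

Definition unit_box (R : realType) (d : nat) : box R d :=
  Box (const_mx 0) (const_mx 1).

Definition side (R : realType) (d : nat) (A : box R d) (j : 'I_d) : R :=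
  hi A 0 j - lo A 0 j.

Definition sum_sides (R : realType) (d : nat) (A : box R d) : R :=
  \sum_(j < d) side A j.

Definition h_minus (R : realType) (d : nat) (A : box R d) : R :=
  inf (range (side A)).

Definition h_plus (R : realType) (d : nat) (A : box R d) : R :=
  sup (range (side A)).

(* [right = false] is the part below the cut, [right = true] the part above. *)
Definition sub_box (R : realType) (d : nat) (right : bool) (A : box R d)
    (j : 'I_d) (s : R) : box R d :=
  if right then Box (\row_k (if k == j then s else lo A 0 k)) (hi A)
  else Box (lo A) (\row_k (if k == j then s else hi A 0 k)).

(* A node of the infinite binary tree is the list of directions leading to it,
   most recent first: the root is [::], the children of v are false :: v and
   true :: v, and v is an ancestor of (or equal to) u iff [suffix v u]. *)
Definition node : Type := seq bool.

(* The draws at every node: waiting time, split coordinate, split location.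
   The values at nodes where the procedure makes no such draw are junk; none of
   the definitions below constrains them beyond measurability. *)
Record draws (R : realType) (d : nat) (T : Type) := Draws {
  wait : node -> T -> R ;
  axis : node -> T -> 'I_d ;
  place : node -> T -> R }.

Fixpoint cell (R : realType) (d : nat) (T : Type) (D : draws R d T)
    (v : node) (w : T) : box R d :=
  if v is b :: u then sub_box b (cell D u w) (axis D u w) (place D u w)
  else unit_box R d.

Fixpoint birth (R : realType) (d : nat) (T : Type) (D : draws R d T)
    (v : node) (w : T) : R :=
  if v is _ :: u then birth D u w + wait D u w else 0.

(* The event that the procedure is applied to the cell at v, i.e. that all the
   strict ancestors of v have been split before the lifetime lambda. *)
Fixpoint reached (R : realType) (d : nat) (T : Type) (lambda : R)
    (D : draws R d T) (v : node) : set T :=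
  if v is _ :: u then
    reached lambda D u `&` [set w | birth D u w + wait D u w <= lambda]
  else setT.

Definition is_split (R : realType) (d : nat) (T : Type) (lambda : R)
    (D : draws R d T) (v : node) : set T :=
  reached lambda D v `&` [set w | birth D v w + wait D v w <= lambda].

Definition is_leaf (R : realType) (d : nat) (T : Type) (lambda : R)
    (D : draws R d T) (v : node) : set T :=
  reached lambda D v `&` [set w | lambda < birth D v w + wait D v w].

Definition wait_events (R : realType) (d : nat) (T : Type) (lambda : R)
    (D : draws R d T) (v : node) : set (set T) :=
  [set reached lambda D v `&` wait D v @^-1` B |
    B in [set B : set R | measurable B]].

Definition axis_events (R : realType) (d : nat) (T : Type) (lambda : R)
    (D : draws R d T) (v : node) : set (set T) :=
  [set is_split lambda D v `&` axis D v @^-1` [set j] | j in setT].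

Definition place_events (R : realType) (d : nat) (T : Type) (lambda : R)
    (D : draws R d T) (v : node) : set (set T) :=
  [set is_split lambda D v `&` place D v @^-1` B |
    B in [set B : set R | measurable B]].

(* Generators of the past of node v: all the draws made at nodes that are
   neither v nor a descendant of v. In particular the past of a cell contains
   everything that happens inside its sibling, so that conditioning on it makes
   the two sub-cells of a split evolve independently. *)
Definition past (R : realType) (d : nat) (T : Type) (lambda : R)
    (D : draws R d T) (v : node) : set (set T) :=
  \bigcup_(u in [set u : node | ~~ suffix v u])
    (wait_events lambda D u `|` axis_events lambda D u
      `|` place_events lambda D u).

(* The law of the pruned Mondrian process with lifetime lambda: each field
   [.._law] gives the conditional distribution of a draw given the past
   (sigma-algebra <<s .. >>), on the event that this draw is made. The
   distribution uniform_prob of the library requires a proof of a < b, whence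
   its density here (cells are nondegenerate almost surely). *)
Record pruned_Mondrian (R : realType) (d : nat) (disp : measure_display)
    (T : measurableType disp) (P : probability T R) (lambda : R)
    (D : draws R d T) : Prop := PrunedMondrian {
  measurable_wait : forall v, measurable_fun setT (wait D v) ;
  measurable_axis : forall v j, measurable (axis D v @^-1` [set j]) ;
  measurable_place : forall v, measurable_fun setT (place D v) ;
  wait_law : forall v (F : set T) (B : set R),
    <<s past lambda D v >> F -> F `<=` reached lambda D v -> measurable B ->
    P (F `&` wait D v @^-1` B) =
      (\int[P]_(w in F) exponential_prob (sum_sides (cell D v w)) B)%E ;
  axis_law : forall v (F : set T) (j : 'I_d),
    <<s past lambda D v `|` wait_events lambda D v >> F ->
    F `<=` is_split lambda D v ->
    P (F `&` axis D v @^-1` [set j]) =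
      (\int[P]_(w in F) (side (cell D v w) j / sum_sides (cell D v w))%:E)%E ;
  place_law : forall v (F : set T) (B : set R),
    <<s past lambda D v `|` wait_events lambda D v
      `|` axis_events lambda D v >> F ->
    F `<=` is_split lambda D v -> measurable B ->
    P (F `&` place D v @^-1` B) =
      (\int[P]_(w in F) \int[lebesgue_measure]_(s in B)
        (uniform_pdf (lo (cell D v w) 0 (axis D v w))
                     (hi (cell D v w) 0 (axis D v w)) s)%:E)%E }.

Definition partition_of (R : realType) (d : nat) (T : Type) (lambda : R)
    (D : draws R d T) (w : T) : set (box R d) :=
  [set A | exists2 v, is_leaf lambda D v w & A = cell D v w].

(* The cells of the final partition containing x. Cells are closed, so x may lie
   in several of them, but only on a negligible event. *)
Definition cells_at (R : realType) (d : nat) (T : Type) (lambda : R)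
    (D : draws R d T) (x : 'rV[R]_d) (w : T) : set (box R d) :=
  [set A | partition_of lambda D w A /\ in_box x A].

(* Main.v *)
From HB Require Import structures.
From mathcomp Require Import measurable_realfun ring lra.
Require Import Defs.
Set Implicit Arguments.
Unset Strict Implicit.
Unset Printing Implicit Defensive.
Import Order.TTheory GRing.Theory Num.Theory.
Import numFieldNormedType.Exports.
Local Open Scope classical_set_scope.
Local Open Scope ring_scope.

(** Follow a fixed box [B] of the unit cube through the recursion. As long as
[B] lies inside one cell, that cell is cut at rate [S], the sum of its sides,
and a cut misses [B] with conditional probability [(S - beta) / S], where
[beta] is the sum of the sides of [B]. Cuts through [B] thus arrive at the
constant rate [beta], whatever the shape of the surrounding cell, and [B] ends
up inside a single leaf with probability [expR (- (lambda * beta))]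
([void_le], [void_ge]); the probability is zero if [B] leaves the unit cube
([void_eq0]).

These void probabilities control both side lengths of the cell of [x]. Let
[A = - ln (1 - delta)], [L = - ln (delta / d)], and let [K = 5 * d * L / A] be
the bound to be proved.
- Smallest side: the cube [core x s] of side [s] is placed in the unit cube so
  as to contain [x]. It survives with probability at least [1 - delta] as soon
  as [lambda * d * s <= A], and then every side of the cell of [x] is at least
  [s]. The choice is [s = Num.min 1 (A / (lambda * d))].
- Largest side: if the cell of [x] contains none of the [2 * d] segments of
  length [u = K * s / 2] that start at [x] along a coordinate direction
  ([arm x u k]), then every side is less than [2 * u = K * s]. A given arm
  survives with probability at most [delta / (2 * d)]: when [u <= 1],
  [lambda * u = 5 * L / 2] and the assumption on [delta] gives [1 <= L]; when
  [1 < u] the arm sticks out of the unit cube.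
The two failure probabilities add up to [2 * delta].

The void probability is obtained from a conservation law on the binary tree of
nodes. Given the past of a node [v] whose cell contains [B], the conditional
probability that [B] survives should be
[expR (- (beta * (lambda - birth D v w)))]; [weight v] is the mean of this
quantity over the event that [v] is reached and [B] lies in its cell.
Integrating out the next waiting time, axis and location shows that [weight v]
is the probability that [v] is a leaf plus the weights of the two children
([weight_rec]). Unfolding this [n] times gives the upper bound by subadditivity.
For the lower bound, a reached cell is a leaf with conditional probability at
least [expR (- (d * lambda))] ([tracked_leaf_ge]), so the weight left at depth
[n] decreases geometrically ([covered_ge]); additivity holds because two leaves
contain [x] only if some cut passes exactly through [x], a null event.

The conditional laws are given on events of the past only. They are turned into
identities between integrals of past-measurable functions by comparing two
measures that agree on a pi-system ([integral_cond_event],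
[integral_cond_density]). *)

(** * Integrals of uniform and exponential densities *)

Section calculus.
Context (R : realType).
Notation mu := (@lebesgue_measure R).

Lemma uniform_pdf_itv (a b c e : R) : a <= c -> c <= e -> e <= b ->
  (\int[mu]_(s in `[c, e]) (uniform_pdf a b s)%:E = ((e - c) / (b - a))%:E)%E.
Proof.
move=> ac ce eb.
under eq_integral => s.
  rewrite inE/= in_itv/= => /andP[cs se].
  rewrite /uniform_pdf (le_trans ac cs) (le_trans se eb)/=.
  over.
rewrite integral_cst//= lebesgue_measure_itv/= lte_fin.
have [_|ec] := ltP c e; first by rewrite -EFinM mulrC.
have -> : e = c by apply/le_anti; rewrite ce ec.
by rewrite subrr mul0r mule0.
Qed.

(** These two versions include [a = b], where the density is zero almost
everywhere and both sides vanish. *)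
Lemma uniform_pdf_itv_left (a b c e : R) : c <= a -> a <= e -> e <= b ->
  (\int[mu]_(s in `[c, e]) (uniform_pdf a b s)%:E = ((e - a) / (b - a))%:E)%E.
Proof.
move=> ca ae eb; rewrite integral_uniform_pdf -(@uniform_pdf_itv a b a e)//.
congr (integral _ _ _); apply/seteqP; split => s /=; rewrite !in_itv/=.
  by move=> [/andP[_ ->] /andP[->]].
by move=> /andP[aes se]; rewrite (le_trans ca aes) se aes (le_trans se eb).
Qed.

Lemma uniform_pdf_itv_right (a b c e : R) : a <= c -> c <= b -> b <= e ->
  (\int[mu]_(s in `[c, e]) (uniform_pdf a b s)%:E = ((b - c) / (b - a))%:E)%E.
Proof.
move=> ac cb be; rewrite integral_uniform_pdf -(@uniform_pdf_itv a b c b)//.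
congr (integral _ _ _); apply/seteqP; split => s /=; rewrite !in_itv/=.
  by move=> [/andP[-> _] /andP[_ ->]].
by move=> /andP[cs sb]; rewrite cs (le_trans sb be) sb (le_trans ac cs).
Qed.

Lemma integral_exponential_pdf_itv0c (r a : R) : 0 <= a ->
  (\int[mu]_(y in `[0%R, a]) (exponential_pdf r y)%:E = (1 - expR (- (r * a)))%:E)%E.
Proof.
rewrite le_eqVlt => /predU1P[<-|a0]; last first.
  by rewrite -[LHS]/(exponential_prob r _) exponential_prob_itv0c// mulNr.
by rewrite set_itv1 integral_set1 mulr0 oppr0 expR0 subrr.
Qed.

Lemma integral_exponential_pdf_setC (r a : R) : 0 < r -> 0 <= a ->
  (\int[mu]_(y in ~` `[0%R, a]) (exponential_pdf r y)%:E = (expR (- (r * a)))%:E)%E.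
Proof.
move=> r0 a0.
have := integral_exponential_pdf r0.
rewrite -(setUv `[0%R, a]%classic) ge0_integral_setU//; last 4 first.
- exact: measurableC.
- rewrite setUv; apply/measurable_EFinP; exact: measurable_exponential_pdf.
- by move=> y _; rewrite lee_fin exponential_pdf_ge0// ltW.
- exact/disj_setPCl.
rewrite integral_exponential_pdf_itv0c//.
case: (integral _ _ _) => [z||]//; rewrite -EFinD => -[h].
by congr EFin; lra.
Qed.

(** One step of the conservation law. With cuts arriving at rate [r] and time
[a] left, the payoff [f] is [1] if no cut arrives, and otherwise it is the
probability [(r - b) / r] of missing a box of total side [b], times the survival
probability over the remaining time. Up to time [a] the integrand is a multiple
of the exponential density of rate [r - b], which makes both pieces explicit. *)
Lemma integral_first_cut (r b a : R) (f : R -> R) : 0 < r -> b <= r -> 0 <= a ->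
  (forall y, 0 <= y <= a -> f y = (r - b) / r * expR (- (b * (a - y)))) ->
  (forall y, a < y -> f y = 1) ->
  (\int[mu]_y (f y * exponential_pdf r y)%:E = (expR (- (b * a)))%:E)%E.
Proof.
move=> r0 br a0 f1 f2.
have mpdf q : measurable_fun setT (EFin \o exponential_pdf q : R -> _).
  by apply/measurable_EFinP; exact: measurable_exponential_pdf.
have e0 y : 0 <= exponential_pdf r y by rewrite exponential_pdf_ge0// ltW.
have E1 y : `[0, a]%classic y -> f y * exponential_pdf r y =
    expR (- (b * a)) * exponential_pdf (r - b) y.
  rewrite /= in_itv/= => y0a; rewrite f1//; case/andP: y0a => y0 ya.
  rewrite !exponential_pdfE//.
  have e : expR (- (b * (a - y))) * expR (- r * y) =
      expR (- (b * a)) * expR (- (r - b) * y).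
    by rewrite -!expRD; congr expR; ring.
  transitivity ((r - b) * (expR (- (b * (a - y))) * expR (- r * y))).
    by field; rewrite gt_eqF.
  by rewrite e; ring.
have E2 y : (~` `[0, a]%classic) y -> f y * exponential_pdf r y = exponential_pdf r y.
  move=> /= /negP; rewrite in_itv/= negb_and -!ltNge => /orP[y0|ya].
    by rewrite lt0_exponential_pdf// mulr0.
  by rewrite f2// mul1r.
rewrite -(setUv `[0, a]%classic) ge0_integral_setU//; last 4 first.
- exact: measurableC.
- apply/measurable_funU => //; first exact: measurableC.
  split.
    apply: eq_measurable_fun
      (measurable_funTS (measurable_funeM (expR (- (b * a)))%:E (mpdf (r - b)))).
    by move=> y; rewrite inE => /E1 ->.
  apply: eq_measurable_fun (measurable_funTS (mpdf r)).
  by move=> y; rewrite inE => /E2 ->.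
- move=> y _; have [y0a|y0a] := pselect (`[0, a]%classic y); rewrite lee_fin.
    by rewrite E1// mulr_ge0 ?expR_ge0// exponential_pdf_ge0// subr_ge0.
  by rewrite E2.
- exact/disj_setPCl.
have -> : (\int[mu]_(y in `[0%R, a]) (f y * exponential_pdf r y)%:E =
  \int[mu]_(y in `[0%R, a]) ((expR (- (b * a)))%:E * (exponential_pdf (r - b) y)%:E))%E.
  by apply: eq_integral => y; rewrite inE => /E1 ->.
have -> : (\int[mu]_(y in ~` `[0%R, a]) (f y * exponential_pdf r y)%:E =
  \int[mu]_(y in ~` `[0%R, a]) (exponential_pdf r y)%:E)%E.
  by apply: eq_integral => y; rewrite inE => /E2 ->.
rewrite ge0_integralZl//; last 2 first.
- exact: (measurable_funTS (mpdf (r - b))).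
- by move=> y _; rewrite lee_fin exponential_pdf_ge0// subr_ge0.
rewrite integral_exponential_pdf_itv0c// integral_exponential_pdf_setC//.
have -> : expR (- (r * a)) = expR (- (b * a)) * expR (- ((r - b) * a)).
  by rewrite -expRD; congr expR; ring.
by rewrite -EFinM -EFinD; congr EFin; ring.
Qed.
End calculus.

(** * From conditional laws to integrals *)

Section weighted.
Local Open Scope ereal_scope.
Context d1 d2 (T : measurableType d1) (U : measurableType d2) (R : realType)
  (mu : {measure set T -> \bar R}) (X : T -> U) (g : T -> R).

(** The image by [X] of the measure of density [g] with respect to [mu]. Both
sides of a conditional law are measures of this form. The proofs are arguments
so that a measure structure can be attached to the function. *)
Definition weighted_push (mX : measurable_fun setT X)
    (mg : measurable_fun setT g) (g0 : forall t, (0 <= g t)%R) (C : set U) : \bar R :=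
  \int[mu]_(t in X @^-1` C) (g t)%:E.

Hypotheses (mX : measurable_fun setT X) (mg : measurable_fun setT g)
  (g0 : forall t, (0 <= g t)%R).

Let m := weighted_push mX mg g0.

Let mXC C : measurable C -> measurable (X @^-1` C).
Proof. by move=> mC; rewrite -[X in measurable X]setTI; exact: mX. Qed.

Let m0 : m set0 = 0.
Proof. by rewrite /m /weighted_push preimage_set0 integral_set0. Qed.

Let m_ge0 C : 0 <= m C.
Proof. by apply: integral_ge0 => t _; rewrite lee_fin g0. Qed.

Let m_sigma_additive : semi_sigma_additive m.
Proof.
move=> F mF tF mUF; rewrite /m /weighted_push; apply: cvg_toP.
  apply: ereal_nondecreasing_is_cvgn => i j ij.
  by apply: lee_sum_nneg_natr => // k _ _; exact: m_ge0.
rewrite preimage_bigcup ge0_integral_bigcup//=.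
- by move=> k; exact: mXC.
- by apply: measurable_funTS; exact/measurable_EFinP.
- by move=> t _; rewrite lee_fin.
- move/trivIsetP: tF => tF; apply/trivIsetP => i j _ _ ij.
  by rewrite -preimage_setI tF// preimage_set0.
Qed.

HB.instance Definition _ := isMeasure.Build _ _ _
  (weighted_push mX mg g0) m0 m_ge0 m_sigma_additive.

Import HBNNSimple.

Lemma integral_weighted_push (f : U -> \bar R) :
  measurable_fun setT f -> (forall u, 0 <= f u) ->
  \int[weighted_push mX mg g0]_u f u = \int[mu]_t (f (X t) * (g t)%:E).
Proof.
move=> mf f0; pose h := nnsfun_approx measurableT mf.
have hf u : f u = limn (fun n => (h n u)%:E).
  by apply/esym/cvg_lim => //; apply: cvg_nnsfun_approx.
have -> : \int[weighted_push mX mg g0]_u f u =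
    limn (fun n => \int[weighted_push mX mg g0]_u (h n u)%:E).
  under eq_integral do rewrite hf.
  apply: monotone_convergence => //.
  - by move=> n; apply/measurable_EFinP; exact/measurable_funP.
  - by move=> n x _; rewrite lee_fin.
  - by move=> x _ a b ab; rewrite lee_fin; exact/lefP/nd_nnsfun_approx.
have -> : \int[mu]_t (f (X t) * (g t)%:E) =
    limn (fun n => \int[mu]_t ((h n (X t))%:E * (g t)%:E)).
  rewrite -monotone_convergence//.
  - apply: eq_integral => t _; apply/esym/cvg_lim => //.
    by apply: cvgeZr => //; exact: cvg_nnsfun_approx.
  - move=> k; apply: emeasurable_funM; last exact/measurable_EFinP.
    by apply/measurable_EFinP; apply: measurableT_comp.
  - by move=> k x _; rewrite mule_ge0// lee_fin.
  - by move=> x _ a b ab; rewrite lee_wpmul2r ?lee_fin//; exact/lefP/nd_nnsfun_approx.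
apply/congr_lim/funext => n.
rewrite integralT_nnsfun sintegralE.
under [RHS]eq_integral => t _.
  rewrite fimfunE -fsumEFin// ge0_mule_fsuml; last first.
    by move=> y; exact: nnfun_muleindic_ge0.
  over.
rewrite ge0_integral_fsum//; last 2 first.
- move=> y; apply: emeasurable_funM; apply/measurable_EFinP => //.
  by apply: measurable_funM => //; apply: (measurableT_comp _ mX).
- by move=> y t _; rewrite mule_ge0 ?lee_fin// -lee_fin EFinM nnfun_muleindic_ge0.
apply: eq_fsbigr => r; rewrite inE => -[u _ <-].
under [RHS]eq_integral do rewrite EFinM -muleA.
rewrite ge0_integralZl ?lee_fin//; last 2 first.
- apply: emeasurable_funM; apply/measurable_EFinP => //.
  by apply: (measurableT_comp _ mX).
- by move=> t _; rewrite mule_ge0// lee_fin.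
congr (_ * _); rewrite /= /weighted_push integral_mkcond.
apply: eq_integral => t _; rewrite muleC.
by rewrite epatch_indic /= indicE /= !indicE.
Qed.
End weighted.

Section conditioning.
Local Open Scope ereal_scope.
Context d (T : measurableType d) (R : realType) (P : probability T R)
  (G : set (set T)).
Hypothesis sG : <<s G >> `<=` @measurable d T.
Let TG : measurableType _ := g_sigma_algebraType G.

Lemma measurable_fun_sub d' (U : measurableType d') (F : set T) (f : T -> U) :
  <<s G >> F ->
  @measurable_fun _ _ TG U F f -> measurable_fun F f.
Proof. by move=> GF mf mF B mB; apply: sG; exact: mf. Qed.

Let measurable_idG : @measurable_fun _ _ T TG setT id.
Proof. by move=> _ B mB; rewrite setTI; exact: sG. Qed.

(** If [k] is the conditional probability of [A] given the sigma-algebra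
generated by [G], then integrating a function known given [G] over [A] amounts to
weighting it by [k]. The measures [phi |-> int_(F & A) phi] and
[phi |-> int_F (phi * k)] agree on the sets of the sigma-algebra, hence on
functions. *)
Lemma integral_cond_event (F A : set T) (k phi : T -> R) :
  <<s G >> F -> measurable A ->
  @measurable_fun _ _ TG _ F k -> (forall w, F w -> (0 <= k w)%R) ->
  (forall H, <<s G >> H -> H `<=` F ->
    P (H `&` A) = \int[P]_(w in H) (k w)%:E) ->
  @measurable_fun _ _ TG _ F phi -> (forall w, F w -> (0 <= phi w)%R) ->
  \int[P]_(w in F `&` A) (phi w)%:E = \int[P]_(w in F) (phi w * k w)%:E.
Proof.
move=> GF mA mk k0 PA mphi phi0.
have mF : measurable F by exact: sG.
have m1 : measurable_fun setT (\1_(F `&` A) : T -> R).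
  by apply: measurable_indic; exact: measurableI.
have m2 : measurable_fun setT (k \_ F : T -> R).
  by apply/(measurable_restrictT _ _).1 => //; exact: measurable_fun_sub.
have p1 w : (0 <= (\1_(F `&` A) : T -> R) w)%R by [].
have p2 w : (0 <= (k \_ F) w)%R by apply: restrict_ge0.
pose mu1 := weighted_push P measurable_idG m1 p1.
pose mu2 := weighted_push P measurable_idG m2 p2.
have E C : @measurable _ TG C -> mu1 C = mu2 C.
  move=> mC; rewrite /mu1 /mu2 /weighted_push preimage_id.
  rewrite integral_indic; [|exact: sG|exact: measurableI].
  have -> : F `&` A `&` C = (C `&` F) `&` A by rewrite setIC setIA.
  rewrite [LHS](PA (C `&` F)); [|exact: (@measurableI _ TG)|by move=> w []].
  rewrite integral_mkcondr; apply: eq_integral => t _.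
  by rewrite !patchE; case: ifPn.
pose f : TG -> \bar R := (EFin \o phi) \_ F.
have mf : measurable_fun [set: TG] f.
  apply/(measurable_restrictT _ _).1 => //.
  by apply/measurable_EFinP.
have f0 u : 0 <= f u by apply: erestrict_ge0 => w Fw; rewrite lee_fin phi0.
have : \int[mu1]_u f u = \int[mu2]_u f u.
  by apply: eq_measure_integral => C mC _; exact: E.
rewrite !integral_weighted_push// => eqf.
rewrite integral_mkcond [RHS]integral_mkcond.
transitivity (\int[P]_t (f t * (\1_(F `&` A) t)%:E)).
  apply: eq_integral => t _; rewrite /f !patchE indicE in_setI.
  by case: (t \in F) => /=; case: (t \in A); rewrite /= ?mule1 ?mule0 ?mul0e.
rewrite [LHS]eqf; apply: eq_integral => t _; rewrite /f !patchE.
by case: ifPn => //; rewrite mule0.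
Qed.

(** If [Y] has conditional density [p] given [G], a function of the past and of
[Y] is integrated by first integrating [Y] out against [p]. Both sides are
integrals against measures on the product of the past with [R]; they agree on
rectangles, which generate its sigma-algebra. *)
Lemma integral_cond_density (F : set T) (Y : T -> R) (p f : T * R -> R) :
  <<s G >> F -> measurable_fun setT Y ->
  @measurable_fun _ _ (TG * R)%type _ (F `*` setT) p ->
  (forall w y, F w -> (0 <= p (w, y))%R) ->
  (forall H B, <<s G >> H -> H `<=` F -> measurable B ->
    P (H `&` Y @^-1` B) =
    \int[P]_(w in H) \int[lebesgue_measure]_(y in B) (p (w, y))%:E) ->
  @measurable_fun _ _ (TG * R)%type _ (F `*` setT) f ->
  (forall w y, F w -> (0 <= f (w, y))%R) ->
  \int[P]_(w in F) (f (w, Y w))%:E =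
  \int[P]_(w in F) \int[lebesgue_measure]_y (f (w, y) * p (w, y))%:E.
Proof.
move=> GF mY mp p0 PY mf f0.
have mF : measurable F by exact: sG.
have mFT : @measurable _ (TG * R)%type (F `*` setT) by apply: measurableX.
have m1 : measurable_fun setT (\1_F : T -> R) by exact: measurable_indic.
have mid : @measurable_fun _ _ (T * R)%type (TG * R)%type setT id.
  apply/measurable_fun_pairP; split.
    exact: (measurableT_comp measurable_idG measurable_fst).
  exact: measurable_snd.
have m2 : measurable_fun setT (p \_ (F `*` setT) : T * R -> R).
  have : @measurable_fun _ _ (TG * R)%type _ setT (p \_ (F `*` setT)).
    by apply/(measurable_restrictT _ _).1.
  by move=> h; exact: (measurableT_comp h mid).
have p1 w : (0 <= (\1_F : T -> R) w)%R by [].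
have p2 w : (0 <= (p \_ (F `*` setT)) w)%R.
  by apply: restrict_ge0 => -[x y] [/= Fx _]; exact: p0.
have mX : @measurable_fun _ _ T (TG * R)%type setT (fun w => (w, Y w)).
  by apply/measurable_fun_pairP; split.
pose mu1 := weighted_push P mX m1 p1.
pose mu2 := weighted_push (P \x lebesgue_measure) mid m2 p2.
pose rect := [set A `*` B | A in @measurable _ TG & B in @measurable _ R].
have E C : @measurable _ (TG * R)%type C -> mu1 C = mu2 C.
  apply: (measure_unique rect (fun _ => setT)).
  - by rewrite /rect measurable_prod_measurableType.
  - move=> _ _ [A mA [B mB <-]] [A' mA' [B' mB' <-]].
    exists (A `&` A'); first exact: measurableI.
    exists (B `&` B'); first exact: measurableI.
    by rewrite setXI.
  - by move=> _; exists setT => //; exists setT => //; rewrite setXTT.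
  - by rewrite bigcup_const//.
  - move=> _ [A mA [B mB <-]].
    transitivity (P ((A `&` F) `&` Y @^-1` B)).
      rewrite /mu1/= /weighted_push integral_indic//; last first.
        by rewrite -[X in measurable X]setTI; apply: (mX) => //; exact: measurableX.
      by congr (P _); apply/seteqP; split => w /=; [move=> [? [? ?]]|move=> [[? ?] ?]].
    rewrite [LHS](PY _ _ _ _ mB); [|exact: (@measurableI _ TG)|by move=> w []].
    rewrite /mu2/= /weighted_push preimage_id [RHS]integral_mkcond.
    rewrite fubini_tonelli1//; first last.
    + by move=> z; apply: erestrict_ge0 => ? _; rewrite lee_fin.
    + apply/(measurable_restrictT _ _).1; first by apply: measurableX => //; exact: sG.
      by apply: measurable_funTS; exact/measurable_EFinP.
    rewrite integral_mkcond; congr (integral _ _ _); apply/funext => w; rewrite !patchE.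
    rewrite /fubini_F in_setI; case: ifPn => [/andP[wA wF]|wAF].
      rewrite [LHS]integral_mkcond; congr (integral _ _ _); apply/funext => y.
      rewrite !patchE !in_setX/= wA wF in_setT.
      by case: (y \in B).
    symmetry; apply: integral0_eq => y _; rewrite !patchE !in_setX/= in_setT andbT.
    by case: (w \in A) wAF => //=; case: (w \in F) => //=; case: ifP.
  - move=> _; rewrite /mu1/= /weighted_push preimage_setT integral_indic// setIT.
    by rewrite (le_lt_trans (probability_le1 _ _))// ltry.
pose g : TG * R -> \bar R := (EFin \o f) \_ (F `*` setT).
have mg : measurable_fun [set: TG * R] g.
  apply/(measurable_restrictT _ _).1 => //.
  by apply/measurable_EFinP.
have g0 u : 0 <= g u.
  by apply: erestrict_ge0 => -[w y] [/= Fw _]; rewrite lee_fin f0.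
have : \int[mu1]_u g u = \int[mu2]_u g u.
  by apply: eq_measure_integral => C mC _; exact: E.
rewrite !integral_weighted_push// fubini_tonelli1//; first last.
- by move=> z; rewrite mule_ge0// lee_fin.
- apply: emeasurable_funM; last exact/measurable_EFinP.
  exact: (measurableT_comp mg mid).
move=> eqf; rewrite integral_mkcond [RHS]integral_mkcond.
transitivity (\int[P]_t (g (t, Y t) * (\1_F t)%:E)).
  apply: eq_integral => t _; rewrite /g !patchE indicE in_setX/= in_setT andbT.
  by case: (t \in F) => /=; rewrite ?mule1 ?mule0.
rewrite [LHS]eqf; congr (integral _ _ _); apply/funext => t.
rewrite /fubini_F /g !patchE.
case: ifPn => tF.
  congr (integral _ _ _); apply/funext => y.
  by rewrite /= !patchE !in_setX/= tF in_setT.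
apply: integral0_eq => y _.
by rewrite /= !patchE !in_setX/= (negbTE tF)/= mul0e.
Qed.
End conditioning.

(** * Measurability of the state of a node *)

Lemma measurable_invr (R : realType) :
  measurable_fun [set: R] (fun x : R => x^-1).
Proof.
have E : [set: R] = [set 0] `|` ~` [set 0] by rewrite setUv.
rewrite E; apply/measurable_funU => //; first exact: measurableC.
split; first exact: measurable_fun_set1.
apply: open_continuous_measurable_fun; first exact: closed_openC.
by move=> x; rewrite inE/= => /eqP x0; exact: inv_continuous.
Qed.

Lemma measurable_fun_div (R : realType) disp (T : measurableType disp)
    (F : set T) (f g : T -> R) :
  measurable_fun F f -> measurable_fun F g ->
  measurable_fun F (fun w => f w / g w).
Proof.
move=> mf mg; apply: measurable_funM => //.
exact: (measurableT_comp (@measurable_invr R)).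
Qed.

Section state_measurability.
Context (R : realType) (d : nat) disp (T : measurableType disp) (lambda : R)
  (D : draws R d T).

(** Stated for the sigma-algebra carried by [T], so that it applies both to the
ambient one and, through [g_sigma_algebraType], to the past of a node. *)
Definition ancestors_measurable (v : node) : Prop :=
  forall u, suffix u v -> u != v ->
    wait_events lambda D u `|` axis_events lambda D u
      `|` place_events lambda D u `<=` measurable.

Lemma ancestors_measurable_parent b u : ancestors_measurable (b :: u) ->
  ancestors_measurable u.
Proof.
move=> H t tu tNu; apply: H.
  by rewrite (suffix_trans tu)// -cat1s suffix_suffix.
apply: contraTneq (size_suffix tu) => ->.
by rewrite /= ltnn.
Qed.

(** The birth time and the cell of [v] are functions of the draws at its strict
ancestors. Those draws are observable only where they are made, which is why
everything is restricted to the event that [v] is reached. *)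
Lemma measurable_state v : ancestors_measurable v ->
  [/\ measurable (reached lambda D v),
      measurable_fun (reached lambda D v) (birth D v),
      forall k, measurable_fun (reached lambda D v) (fun w => lo (cell D v w) 0 k)
    & forall k, measurable_fun (reached lambda D v) (fun w => hi (cell D v w) 0 k)].
Proof.
elim: v => [|b u ih] pm; first by split=> //= k; exact: measurable_cst.
have [mr mb ml mh] := ih (ancestors_measurable_parent pm).
have {pm}: wait_events lambda D u `|` axis_events lambda D u
      `|` place_events lambda D u `<=` measurable.
  apply: pm; first by rewrite -cat1s suffix_suffix.
  by apply/eqP => /(congr1 size)/= /eqP; rewrite ltn_eqF.
move=> pm.
have mw : measurable_fun (reached lambda D u) (wait D u).
  by move=> _ B mB; apply: pm; left; left; exists B.
have mbw : measurable_fun (reached lambda D u) (fun w => birth D u w + wait D u w).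
  exact: measurable_funD.
have mr' : measurable (reached lambda D (b :: u)).
  by have := mbw mr _ (measurable_itv `]-oo, lambda]); rewrite set_itvNyc.
have sub : reached lambda D (b :: u) `<=` reached lambda D u by move=> w [].
have mp : measurable_fun (reached lambda D (b :: u)) (place D u).
  by move=> _ B mB; apply: pm; right; exists B.
have ma k : measurable_fun (reached lambda D (b :: u)) (fun w => k == axis D u w).
  apply: (measurable_fun_bool true) => //.
  rewrite (_ : _ `&` _ = is_split lambda D u `&` axis D u @^-1` [set k]).
    by apply: pm; left; right; exists k.
  apply/seteqP; split => w /= [ru e]; split => //.
    exact/esym/eqP.
  by rewrite -e eqxx.
have mif (f : T -> R) k : measurable_fun (reached lambda D u) f ->
    measurable_fun (reached lambda D (b :: u))
      (fun w => if k == axis D u w then place D u w else f w).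
  move=> mf; apply: measurable_fun_if => //.
  - by apply: measurable_funS mp => // w [].
  - by apply: measurable_funS mf => // w [] /sub.
split => //; first by apply: measurable_funS mbw.
- move=> k; case: b mif {mr' sub mp ma} => mif.
    rewrite (_ : (fun w => _) = (fun w => if k == axis D u w then place D u w
        else lo (cell D u w) 0 k)); first exact: mif.
    by apply/funext => w /=; rewrite mxE.
  apply: measurable_funS (ml k) => //.
  by move=> w [].
- move=> k; case: b mif {mr' sub mp ma} => mif.
    apply: measurable_funS (mh k) => //.
    by move=> w [].
  rewrite (_ : (fun w => _) = (fun w => if k == axis D u w then place D u w
      else hi (cell D u w) 0 k)); first exact: mif.
  by apply/funext => w /=; rewrite mxE.
Qed.

Section sub_reached.
Variables (v : node) (F : set T).
Hypotheses (pm : ancestors_measurable v) (Fv : F `<=` reached lambda D v).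

Lemma measurable_side j : measurable_fun F (fun w => side (cell D v w) j).
Proof.
have [mr _ ml mh] := measurable_state pm.
by apply: (measurable_funS mr Fv); exact: measurable_funB.
Qed.

Lemma measurable_sum_sides : measurable_fun F (fun w => sum_sides (cell D v w)).
Proof. by apply: measurable_sum => j; exact: measurable_side. Qed.
End sub_reached.
End state_measurability.

(** * Cells containing a fixed box *)

Definition box_sub (R : realType) d (A B : box R d) : Prop :=
  forall j, lo B 0 j <= lo A 0 j /\ hi A 0 j <= hi B 0 j.

Section tracked.
Context (R : realType) (d : nat) (T : Type) (D : draws R d T) (lambda : R)
  (B : box R d).

(** All cells on the way to [v] contain [B]. The inclusion in the unit cube and
the sign of the waiting times hold almost surely; having them in the event gives
the bounds [sum_sides_le] and [tracked_birth_ge0] everywhere on it, and confines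
the admissible cut locations to a fixed interval ([cut_range]). *)
Fixpoint tracked (v : node) : set T :=
  if v is _ :: u then
    tracked u `&` [set w | [/\ box_sub B (cell D v w),
      box_sub (cell D v w) (unit_box R d) & 0 <= wait D u w]]
  else [set w | box_sub B (unit_box R d)].

Lemma tracked_box v w : tracked v w ->
  box_sub B (cell D v w) /\ box_sub (cell D v w) (unit_box R d).
Proof. by case: v => [|b u] /=; [move=> ?; split|move=> [_ []]]. Qed.

Lemma tracked_birth_ge0 v w : tracked v w -> 0 <= birth D v w.
Proof. by elim: v => //= b u ih [/ih ? [_ _ ?]]; exact: addr_ge0. Qed.

Lemma reached_birth v w : 0 <= lambda -> reached lambda D v w ->
  birth D v w <= lambda.
Proof. by case: v => //= b u _ []. Qed.

Lemma side_le1 (A : box R d) j : box_sub A (unit_box R d) -> side A j <= 1.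
Proof. by move=> /(_ j)[]; rewrite !mxE /side => ? ?; lra. Qed.

Lemma sum_sides_le (A : box R d) : box_sub A (unit_box R d) ->
  sum_sides A <= d%:R.
Proof.
move=> A1; rewrite -[X in _ <= X%:R]card_ord -sumr_const.
by apply: ler_sum => j _; exact: side_le1.
Qed.

Lemma side_sub (A C : box R d) j : box_sub A C -> side A j <= side C j.
Proof. by move=> /(_ j)[]; rewrite /side; lra. Qed.

Lemma sum_sides_sub (A C : box R d) : box_sub A C -> sum_sides A <= sum_sides C.
Proof. by move=> AC; apply: ler_sum => j _; exact: side_sub. Qed.

End tracked.

Section tracked_measurability.
Context (R : realType) (d : nat) disp (T : measurableType disp) (lambda : R)
  (D : draws R d T) (B : box R d).

Lemma measurable_forall_ord (F : set T) (Q : 'I_d -> set T) : measurable F ->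
  (forall j, measurable (F `&` Q j)) -> measurable (F `&` [set w | forall j, Q j w]).
Proof.
move=> mF mQ.
rewrite (_ : _ `&` _ = F `&` \bigcap_(j in [set: 'I_d]) (F `&` Q j)); last first.
  apply/seteqP; split => w /= [Fw h]; split => //.
  by move=> j; exact: (h j Logic.I).2.
by apply: measurableI => //; exact: fin_bigcap_measurable.
Qed.

Lemma measurable_le_fun (F : set T) (f g : T -> R) : measurable F ->
  measurable_fun F f -> measurable_fun F g ->
  measurable (F `&` [set w | f w <= g w]).
Proof.
move=> mF mf mg; rewrite (_ : [set w | _] = (fun w => f w <= g w) @^-1` [set true]).
  by apply: measurable_fun_ler.
by apply/seteqP; split => w /=.
Qed.

Lemma measurable_box_sub v (A : box R d) : ancestors_measurable lambda D v ->
  measurable (reached lambda D v `&` [set w | box_sub A (cell D v w)]) /\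
  measurable (reached lambda D v `&` [set w | box_sub (cell D v w) A]).
Proof.
move=> pm; have [mr _ ml mh] := measurable_state pm.
have conj (f1 f2 g1 g2 : T -> R) :
    measurable_fun (reached lambda D v) f1 ->
    measurable_fun (reached lambda D v) f2 ->
    measurable_fun (reached lambda D v) g1 ->
    measurable_fun (reached lambda D v) g2 ->
    measurable (reached lambda D v `&` [set w | f1 w <= f2 w /\ g1 w <= g2 w]).
  move=> mf1 mf2 mg1 mg2.
  rewrite (_ : _ `&` _ = (reached lambda D v `&` [set w | f1 w <= f2 w]) `&`
     (reached lambda D v `&` [set w | g1 w <= g2 w])).
    by apply: measurableI; exact: measurable_le_fun.
  apply/seteqP; split => w /=; first by move=> [? []].
  by move=> [[? ?] [? ?]].
by split; apply: measurable_forall_ord => // j; exact: conj.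
Qed.

Lemma measurable_tracked v : ancestors_measurable lambda D v ->
  measurable (reached lambda D v `&` tracked D B v).
Proof.
elim: v => [|b u ih] pm.
  rewrite setTI; have [h|h] := pselect (box_sub B (unit_box R d)).
    by rewrite (_ : tracked _ _ _ = setT)//; apply/seteqP; split => // w.
  by rewrite (_ : tracked _ _ _ = set0)//; apply/seteqP; split => // w.
have mu := ih (ancestors_measurable_parent pm).
have [m1 _] := measurable_box_sub B pm.
have mw : measurable (reached lambda D u `&` wait D u @^-1` `[0, +oo[%classic).
  apply: (pm u).
  - by rewrite -cat1s suffix_suffix.
  - by apply/eqP => /(congr1 size)/= /eqP; rewrite ltn_eqF.
  - by left; left; exists `[0, +oo[%classic => //; exact: measurable_itv.
have [_ m2] := measurable_box_sub (unit_box R d) pm.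
have [mr _ _ _] := measurable_state pm.
rewrite (_ : _ `&` _ = (reached lambda D u `&` tracked D B u) `&`
  (reached lambda D (b :: u) `&` [set w | box_sub B (cell D (b :: u) w)]) `&`
  (reached lambda D (b :: u) `&`
     [set w | box_sub (cell D (b :: u) w) (unit_box R d)]) `&`
  (reached lambda D u `&` wait D u @^-1` `[0, +oo[%classic)).
  by do 3 apply: measurableI => //.
apply/seteqP; split => w /=; rewrite in_itv/= andbT.
  by move=> [[ru bw]] [tu [? ? ?]].
by move=> [[[[ru tu] [[_ bw] ?]] [_ ?]] [_ ?]].
Qed.
End tracked_measurability.

(** * The filtration and the law of one cut *)

Section filtration.
Context (R : realType) (d : nat) disp (T : measurableType disp)
  (P : probability T R) (lambda : R) (D : draws R d T).
Hypothesis M : pruned_Mondrian P lambda D.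

Lemma ancestors_measurable_past (G : set (set T)) v : past lambda D v `<=` G ->
  @ancestors_measurable R d _ (g_sigma_algebraType G) lambda D v.
Proof.
move=> vG u uv uNv A uA; apply: sub_sigma_algebra; apply: vG; exists u => //=.
apply: contra uNv => vu; apply/eqP.
have /suffixP[s e] := uv; have := size_suffix vu.
by rewrite e size_cat -[X in (_ <= X)%N]add0n leq_add2r leqn0 => /nilP ->.
Qed.

Let birth_measurable v : measurable_fun setT (birth D v).
Proof.
elim: v => [|b u ih]; first exact: measurable_cst.
by apply: measurable_funD => //; exact: measurable_wait M u.
Qed.

Let split_measurable v :
  measurable [set w | birth D v w + wait D v w <= lambda].
Proof.
have m : measurable_fun setT (fun w => birth D v w + wait D v w).
  by apply: measurable_funD => //; exact: measurable_wait M v.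
by have := m measurableT _ (measurable_itv `]-oo, lambda]); rewrite set_itvNyc setTI.
Qed.

Let reached_measurable v : measurable (reached lambda D v).
Proof. by elim: v => [|b u ih] //=; exact: measurableI. Qed.

Lemma draws_measurable v :
  wait_events lambda D v `|` axis_events lambda D v
    `|` place_events lambda D v `<=` measurable.
Proof.
move=> A [[]|] [B].
- move=> mB <-; apply: measurableI => //; rewrite -[X in measurable X]setTI.
  exact: measurable_wait M v _ _ _.
- move=> _ <-; apply: measurableI; last exact: measurable_axis M v B.
  exact: measurableI.
- move=> mB <-; apply: measurableI; first exact: measurableI.
  rewrite -[X in measurable X]setTI; exact: measurable_place M v _ _ _.
Qed.

Lemma ancestors_measurableT v : ancestors_measurable lambda D v.
Proof. by move=> u _ _; exact: draws_measurable. Qed.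

Let past_sub v : past lambda D v `<=` measurable.
Proof. by move=> A [u _]; exact: draws_measurable. Qed.

Lemma sigma_past v : <<s past lambda D v >> `<=` @measurable _ T.
Proof. by apply: smallest_sub; [exact: sigma_algebra_measurable|exact: past_sub]. Qed.

Lemma sigma_past_wait v :
  <<s past lambda D v `|` wait_events lambda D v >> `<=` @measurable _ T.
Proof.
apply: smallest_sub; first exact: sigma_algebra_measurable.
move=> A [|?]; first exact: past_sub.
by apply: (@draws_measurable v); left; left.
Qed.

Lemma sigma_past_wait_axis v :
  <<s past lambda D v `|` wait_events lambda D v `|` axis_events lambda D v >>
    `<=` @measurable _ T.
Proof.
apply: smallest_sub; first exact: sigma_algebra_measurable.
move=> A [[|?]|?]; first exact: past_sub.
- by apply: (@draws_measurable v); left; left.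
- by apply: (@draws_measurable v); left; right.
Qed.

End filtration.

Section child.
Context (R : realType) (d : nat) disp (T : measurableType disp)
  (P : probability T R) (lambda : R) (D : draws R d T).
Hypothesis M : pruned_Mondrian P lambda D.
Variable B : box R d.
Hypothesis B0 : forall j, lo B 0 j <= hi B 0 j.

(** Along coordinate [j], the part of the side of [A] where a cut leaves [B] in
the child [b]: left of [B] for the right child, right of [B] for the left one. *)
Definition gap (b : bool) (A : box R d) (j : 'I_d) : R :=
  if b then lo B 0 j - lo A 0 j else hi A 0 j - hi B 0 j.

Definition cut_range (b : bool) (j : 'I_d) : set R :=
  if b then `[0, lo B 0 j]%classic else `[hi B 0 j, 1]%classic.

Definition tracked_split (v : node) : set T :=
  is_split lambda D v `&` tracked D B v `&` [set w | 0 <= wait D v w].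

(** Once the axis is known, [B] survives in the child [b] exactly when the location
falls into an interval that does not depend on the cell; the law of the location
is available for such deterministic sets. *)
Lemma tracked_childE b v :
  reached lambda D (b :: v) `&` tracked D B (b :: v) =
  \big[setU/set0]_(j <- enum 'I_d)
     ((tracked_split v `&` axis D v @^-1` [set j]) `&` place D v @^-1` cut_range b j).
Proof.
rewrite -bigcup_seq; apply/seteqP; split => w /=.
  move=> [[rv bw]] [tv [sB s1 wt]].
  exists (axis D v w); first by rewrite /= mem_enum.
  split; first by split => //; split.
  move: sB s1 => /(_ (axis D v w))[sl sh] /(_ (axis D v w))[sl1 sh1].
  rewrite /cut_range; case: b sl sh sl1 sh1 => /=; rewrite !mxE eqxx in_itv/=.
    by move=> -> _ ->.
  by move=> _ -> _ ->.
move=> [j _] [[[[[rv bw] tv] wt] /= aj] cj].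
have [sB s1] := tracked_box tv.
split=> //; split=> //; split => // k; have [sl sh] := sB k; have [sl1 sh1] := s1 k.
  move: cj; rewrite /cut_range; case: b => /=; rewrite !mxE in_itv/= aj.
    by move=> /andP[_ cj]; split => //; case: eqP => // ->.
  by move=> /andP[cj _]; split => //; case: eqP => // ->.
move: cj; rewrite /cut_range; case: b => /=; rewrite !mxE in_itv/= aj.
  move=> /andP[cj _]; move: sl1 sh1; rewrite !mxE => ? ?.
  by split => //; case: eqP => // ->.
move=> /andP[_ cj]; move: sl1 sh1; rewrite !mxE => ? ?.
by split => //; case: eqP => // ->.
Qed.

Section child_integral.
Variables (b : bool) (v : node) (phi : T -> R).
Let G2 := past lambda D v `|` wait_events lambda D v.
Let G3 := past lambda D v `|` wait_events lambda D v `|` axis_events lambda D v.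

Lemma measurable_tracked_split G : past lambda D v `|` wait_events lambda D v `<=` G ->
  <<s G >> (tracked_split v).
Proof.
move=> vG.
have pm : @ancestors_measurable R d _ (g_sigma_algebraType G) lambda D v.
  by apply: ancestors_measurable_past => A pA; apply: vG; left.
have [mr mb _ _] := measurable_state pm.
have mt := measurable_tracked B pm.
have mw : @measurable_fun _ _ (g_sigma_algebraType G) _ (reached lambda D v) (wait D v).
  by move=> _ A mA; apply: sub_sigma_algebra; apply: vG; right; exists A.
have ms : @measurable _ (g_sigma_algebraType G) (is_split lambda D v).
  have := measurable_funD mb mw mr (measurable_itv `]-oo, lambda]).
  by rewrite set_itvNyc.
rewrite (_ : tracked_split v = is_split lambda D v
    `&` (reached lambda D v `&` tracked D B v)
    `&` (reached lambda D v `&` wait D v @^-1` `[0, +oo[)).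
  apply: (@measurableI _ (g_sigma_algebraType G)).
    exact: (@measurableI _ (g_sigma_algebraType G)).
  exact: mw.
rewrite /tracked_split; apply/seteqP; split => w /=; rewrite in_itv/= andbT.
  by move=> [[[? ?] ?] ?].
by move=> [[[? ?] [? ?]] [? ?]].
Qed.

Hypothesis mphi : @measurable_fun _ _ (g_sigma_algebraType G2) _ (tracked_split v) phi.
Hypothesis phi0 : forall w, tracked_split v w -> 0 <= phi w.

Let ratio j w : R := gap b (cell D v w) j / side (cell D v w) j.

Let side_ge0 w j : tracked_split v w -> 0 <= side (cell D v w) j.
Proof.
move=> [[_ t] _]; have [sB _] := tracked_box t; have [? ?] := sB j; have := B0 j.
by rewrite /side; lra.
Qed.

Let gap_ge0 w j : tracked_split v w -> 0 <= gap b (cell D v w) j.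
Proof.
move=> [[_ t] _]; have [sB _] := tracked_box t; have [? ?] := sB j.
by rewrite /gap; case: b; rewrite subr_ge0.
Qed.

Let cut_law w j : tracked_split v w -> axis D v w = j ->
  (\int[lebesgue_measure]_(s in cut_range b j)
        (uniform_pdf (lo (cell D v w) 0 (axis D v w))
                     (hi (cell D v w) 0 (axis D v w)) s)%:E = (ratio j w)%:E)%E.
Proof.
move=> [[_ t] _] ->; have [sB s1] := tracked_box t; have [l1 h1] := sB j.
have := s1 j; rewrite !mxE => -[l2 h2]; have Bj := B0 j.
rewrite /cut_range /ratio /gap /side; case: (b).
  by rewrite uniform_pdf_itv_left// (le_trans Bj h1).
by rewrite uniform_pdf_itv_right// (le_trans l1).
Qed.

(** Given the past and the waiting time at [v], the box survives the cut and goes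
to the child [b] with probability [sum of the gaps / sum of the sides]. The axis
is [j] with probability [side j / sum_sides], the location then falls into the
gap with probability [gap j / side j], and the product telescopes, also when
[side j = 0] because then the gap is empty. *)
Lemma integral_child :
  (\int[P]_(w in reached lambda D (b :: v) `&` tracked D B (b :: v)) (phi w)%:E =
   \int[P]_(w in tracked_split v)
     (phi w * ((\sum_j gap b (cell D v w) j) / sum_sides (cell D v w)))%:E)%E.
Proof.
have m3 : <<s G3 >> (tracked_split v) by apply: measurable_tracked_split => A ?; left.
have m2 : <<s G2 >> (tracked_split v) by exact: measurable_tracked_split.
have s2 : <<s G2 >> `<=` @measurable _ T by exact: (sigma_past_wait M).
have s3 : <<s G3 >> `<=` @measurable _ T by exact: (sigma_past_wait_axis M).
have mF3 j : <<s G3 >> (tracked_split v `&` axis D v @^-1` [set j]).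
  rewrite (_ : _ `&` _ = tracked_split v `&`
      (is_split lambda D v `&` axis D v @^-1` [set j])); last first.
    by apply/seteqP; split => w /=; [move=> [[[]]]|move=> [? []]].
  apply: (@measurableI _ (g_sigma_algebraType G3)) => //.
  by apply: sub_sigma_algebra; right; exists j.
have mrng j : measurable (cut_range b j).
  by rewrite /cut_range; case: (b); exact: measurable_itv.
have mpl j : measurable (place D v @^-1` cut_range b j).
  by rewrite -[X in measurable X]setTI; exact: (measurable_place M).
have mdraw G : past lambda D v `<=` G ->
    [/\ forall j, @measurable_fun _ _ (g_sigma_algebraType G) _
          (reached lambda D v) (fun w => gap b (cell D v w) j),
        forall j, @measurable_fun _ _ (g_sigma_algebraType G) _
          (reached lambda D v) (fun w => side (cell D v w) j)
      & @measurable_fun _ _ (g_sigma_algebraType G) _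
          (reached lambda D v) (fun w => sum_sides (cell D v w))].
  move=> vG; have pm := ancestors_measurable_past vG.
  have [mr _ ml mh] := measurable_state pm.
  split; [move=> j|move=> j|]; last 2 first.
  - exact: (measurable_side pm).
  - exact: (measurable_sum_sides pm).
  by rewrite /gap; case: (b); apply: measurable_funB => //; exact: measurable_cst.
have tsr : tracked_split v `<=` reached lambda D v by move=> w [[[]]].
have mphiT : measurable_fun (tracked_split v) phi by exact: (measurable_fun_sub s2).
have sub j : tracked_split v `&` axis D v @^-1` [set j]
      `&` place D v @^-1` cut_range b j
   `<=` tracked_split v by move=> w [[]].
rewrite tracked_childE ge0_integral_bigsetU//; last 5 first.
- by move=> j; apply: measurableI => //; exact: s3.
- exact: enum_uniq.
- apply/trivIsetP => i j _ _ /eqP ij; rewrite -subset0 => w /= [[[_ ai] _] [[_ aj] _]].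
  by apply: ij; rewrite -ai -aj.
- rewrite -bigcup_seq; apply: (measurable_funS (s2 _ m2)).
    by move=> w [j _] /sub.
  exact/measurable_EFinP.
- by move=> w; rewrite -bigcup_seq => -[j _] /sub tw; rewrite lee_fin phi0.
have mG2 : past lambda D v `<=` G2 by move=> A; left.
have mG3 : past lambda D v `<=` G3 by move=> A ?; left; left.
have G23 : <<s G2 >> `<=` <<s G3 >>.
  apply: smallest_sub; first exact: smallest_sigma_algebra.
  by move=> A ?; apply: sub_sigma_algebra; left.
have [g2 sd2 ss2] := mdraw _ mG2.
have [g3 sd3 ss3] := mdraw _ mG3.
have mr2 : @measurable _ (g_sigma_algebraType G2) (reached lambda D v).
  by have [] := measurable_state (ancestors_measurable_past mG2).
have mr3 : @measurable _ (g_sigma_algebraType G3) (reached lambda D v).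
  by have [] := measurable_state (ancestors_measurable_past mG3).
have ratio0 j w : tracked_split v w -> 0 <= ratio j w.
  by move=> tw; rewrite divr_ge0 ?gap_ge0 ?side_ge0.
have S0 w : tracked_split v w -> 0 <= sum_sides (cell D v w).
  by move=> tw; apply: sumr_ge0 => j _; exact: side_ge0.
have step3 j :
  (\int[P]_(w in tracked_split v `&` axis D v @^-1` [set j] `&`
     place D v @^-1` cut_range b j) (phi w)%:E =
   \int[P]_(w in tracked_split v `&` axis D v @^-1` [set j]) (phi w * ratio j w)%:E)%E.
  apply: (integral_cond_event s3) => //.
  - apply: (measurable_funS mr3); first by move=> w [/tsr].
    exact: measurable_fun_div.
  - by move=> w [tw _]; exact: ratio0.
  - move=> H mH HF.
    rewrite [LHS](place_law M mH)//; last by move=> w /HF [[[]]].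
    apply: eq_integral => w; rewrite inE => /HF[tw aw].
    exact: cut_law.
  - apply: (@measurable_funS _ _ (g_sigma_algebraType G3) _ (tracked_split v)) => //.
    by move=> _ A mA; apply: G23; exact: mphi.
  - by move=> w [tw _]; exact: phi0.
have step2 j :
  (\int[P]_(w in tracked_split v `&` axis D v @^-1` [set j])
     (phi w * ratio j w)%:E =
   \int[P]_(w in tracked_split v)
     (phi w * ratio j w * (side (cell D v w) j / sum_sides (cell D v w)))%:E)%E.
  apply: (integral_cond_event s2) => //.
  - exact: (measurable_axis M).
  - apply: (measurable_funS mr2 tsr); exact: measurable_fun_div.
  - by move=> w tw; rewrite divr_ge0 ?side_ge0 ?S0.
  - move=> H mH HF.
    by rewrite [LHS](axis_law M j mH)// => w /HF [[]].
  - apply: measurable_funM => //; apply: (measurable_funS mr2 tsr).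
    exact: measurable_fun_div.
  - by move=> w tw; rewrite mulr_ge0 ?phi0 ?ratio0.
under eq_bigr do rewrite step3 step2.
rewrite big_enum/= -ge0_integral_sum//; last 3 first.
- exact: s2.
- move=> j; apply/measurable_EFinP; apply: (measurable_fun_sub s2 m2).
  apply: measurable_funM; first apply: measurable_funM => //.
    by apply: (measurable_funS mr2 tsr); exact: measurable_fun_div.
  by apply: (measurable_funS mr2 tsr); exact: measurable_fun_div.
- by move=> j w tw; rewrite lee_fin; apply: mulr_ge0;
  [by rewrite mulr_ge0 ?phi0 ?ratio0|by rewrite divr_ge0 ?side_ge0 ?S0].
apply: eq_integral => w; rewrite inE => tw.
rewrite sumEFin; congr EFin.
rewrite mulr_suml mulr_sumr; apply: eq_bigr => j _.
rewrite -mulrA; congr (_ * _); rewrite mulrA; congr (_ / _).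
rewrite /ratio; have [s0|s0] := eqVneq (side (cell D v w) j) 0; last by rewrite divfK.
rewrite s0 mulr0; apply/eqP; rewrite eq_le gap_ge0//= -s0.
have [[_ t] _] := tw; have [sB _] := tracked_box t; have [? ?] := sB j.
by rewrite /gap /side; have := B0 j; case: (b); lra.
Qed.
End child_integral.
End child.

(** * The conservation law *)

Lemma measurable_fun_lift_fst (R : realType) d
    (U : measurableType d) (F : set U) (g : U -> R) :
  measurable F -> measurable_fun F g ->
  measurable_fun (F `*` [set: R]) (fun z : U * R => g z.1).
Proof.
move=> mF mg; apply: (@measurable_comp _ _ _ _ _ _ F) => //.
  by move=> _ [[x y] [? _] <-].
exact: measurable_funTS measurable_fst.
Qed.

Lemma measurable_fun_exponential_pdf (R : realType) d
    (U : measurableType d) (F : set U) (g : U -> R) :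
  measurable F -> measurable_fun F g ->
  measurable_fun (F `*` [set: R]) (fun z : U * R => exponential_pdf (g z.1) z.2).
Proof.
move=> mF mg; have mFT : measurable (F `*` [set: R]) by exact: measurableX.
have mg1 := measurable_fun_lift_fst mF mg.
have m2 : measurable_fun (F `*` [set: R]) (fun z : U * R => z.2).
  exact: measurable_funTS measurable_snd.
have -> : (fun z : U * R => exponential_pdf (g z.1) z.2) =
    (fun z => if 0 <= z.2 then g z.1 * expR (- g z.1 * z.2) else 0).
  apply/funext => -[x y] /=; have [y0|y0] := leP 0 y.
    by rewrite exponential_pdfE.
  by rewrite lt0_exponential_pdf.
have mb : measurable_fun (F `*` [set: R]) (fun z : U * R => 0 <= z.2).
  by apply: measurable_fun_ler => //; exact: measurable_cst.
apply: measurable_fun_if => //.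
apply: (measurable_funS mFT); first by move=> z [].
apply: measurable_funM => //; apply: measurableT_comp => //.
by apply: measurable_funM => //; exact: measurableT_comp.
Qed.

Section step.
Context (R : realType) (d : nat) disp (T : measurableType disp)
  (P : probability T R) (lambda : R) (D : draws R d T).
Hypothesis M : pruned_Mondrian P lambda D.
Hypothesis lambda0 : 0 <= lambda.
Variable B : box R d.
Hypothesis B0 : forall j, lo B 0 j <= hi B 0 j.

Notation F v := (reached lambda D v `&` tracked D B v).

Section wait.
Variables (v : node) (c : T -> R).
Let TG : measurableType _ := g_sigma_algebraType (past lambda D v).

(** Used with [c] constant equal to the sum of the sides of [B], where the payoff
is the survival probability computed after the next waiting time, and with [c]
the sum of the sides of the cell, where it is the indicator that no cut occurs. *)
Definition cut_payoff (z : T * R) : R :=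
  if z.2 <= lambda - birth D v z.1 then
    if 0 <= z.2 then
      (sum_sides (cell D v z.1) - c z.1) / sum_sides (cell D v z.1) *
      expR (- (c z.1 * (lambda - birth D v z.1 - z.2)))
    else 0
  else 1.

Hypothesis mc : @measurable_fun _ _ TG _ (F v) c.
Hypothesis cS : forall w, F v w -> 0 <= c w <= sum_sides (cell D v w).

Let pmG : @ancestors_measurable R d _ TG lambda D v.
Proof. exact: ancestors_measurable_past. Qed.

Let sG := sigma_past M (v := v).

Let mF : @measurable _ TG (F v). Proof. exact: measurable_tracked pmG. Qed.

Let Fr : F v `<=` reached lambda D v. Proof. by move=> w []. Qed.

Let mS : @measurable_fun _ _ TG _ (F v) (fun w => sum_sides (cell D v w)).
Proof. exact: (measurable_sum_sides pmG). Qed.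

Let mb : @measurable_fun _ _ TG _ (F v) (birth D v).
Proof. by have [mr mb _ _] := measurable_state pmG; exact: (measurable_funS mr). Qed.

Let mpay : @measurable_fun _ _ (TG * R)%type _ (F v `*` [set: R]) cut_payoff.
Proof.
have mFT : @measurable _ (TG * R)%type (F v `*` [set: R]) by exact: measurableX.
have m2 : @measurable_fun _ _ (TG * R)%type _ (F v `*` [set: R]) (fun z => z.2).
  exact: measurable_funTS measurable_snd.
have mc' := measurable_fun_lift_fst mF mc.
have mS' := measurable_fun_lift_fst mF mS.
have mb' := measurable_fun_lift_fst mF mb.
have ml : @measurable_fun _ _ (TG * R)%type _ (F v `*` [set: R])
    (fun z => lambda - birth D v z.1).
  by apply: measurable_funB => //; exact: measurable_cst.
have b1 : @measurable_fun _ _ (TG * R)%type _ (F v `*` [set: R])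
  (fun z => z.2 <= lambda - birth D v z.1) by exact: measurable_fun_ler.
have b2 : @measurable_fun _ _ (TG * R)%type _ (F v `*` [set: R])
  (fun z => 0 <= z.2) by apply: measurable_fun_ler => //; exact: measurable_cst.
apply: measurable_fun_if => //.
apply: (@measurable_funS _ _ (TG * R)%type _ (F v `*` [set: R])) => //.
apply: measurable_fun_if => //.
apply: (@measurable_funS _ _ (TG * R)%type _ (F v `*` [set: R])) => //.
apply: measurable_funM.
  by apply: measurable_fun_div => //; exact: measurable_funB.
apply: measurableT_comp => //; apply: measurableT_comp => //.
by apply: measurable_funM => //; exact: measurable_funB.
Qed.

Lemma cut_payoff_ge0 w y : F v w -> 0 <= cut_payoff (w, y).
Proof.
move=> Fw; rewrite /cut_payoff/=; case: ifP => //; case: ifP => // _ _.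
have /andP[c0 cs] := cS Fw.
by rewrite mulr_ge0 ?expR_ge0// divr_ge0 ?subr_ge0// (le_trans c0).
Qed.

(** At rate zero the exponential density vanishes identically, so the law of the
waiting time forces such cells to have probability zero. *)
Lemma degenerate_cell_null :
  P (F v `&` [set w | sum_sides (cell D v w) <= 0]) = 0%E.
Proof.
set N := _ `&` _.
have mN : <<s past lambda D v >> N.
  apply: (@measurable_le_fun R _ TG) => //; exact: measurable_cst.
have := wait_law M mN (fun w Nw => Fr Nw.1) measurableT.
rewrite preimage_setT setIT => ->.
apply: integral0_eq => w [Fw /= S0].
have /andP[c0 cs] := cS Fw.
have -> : sum_sides (cell D v w) = 0.
  by apply/le_anti; rewrite S0 (le_trans c0).
rewrite /exponential_prob; apply: integral0_eq => y _.
by rewrite /exponential_pdf patchE; case: ifP; rewrite ?mul0r.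
Qed.

(** The waiting time is integrated out with [integral_first_cut]; this needs a
positive rate, hence the removal of the null set [N]. *)
Lemma integral_cut_payoff :
  (\int[P]_(w in F v) (cut_payoff (w, wait D v w))%:E =
   \int[P]_(w in F v) (expR (- (c w * (lambda - birth D v w))))%:E)%E.
Proof.
set N := [set w | sum_sides (cell D v w) <= 0].
have mN : <<s past lambda D v >> (F v `&` N).
  apply: (@measurable_le_fun R _ TG) => //; exact: measurable_cst.
have FN : F v `\` (F v `&` N) = F v `&` [set w | 0 < sum_sides (cell D v w)].
  apply/seteqP; split => w /=; rewrite /N/= ltNge.
    by move=> [? h]; split => //; apply/negP => ?; apply: h.
  by move=> [? /negP ?]; split => // -[].
have mpayT : measurable_fun (F v) (fun w => cut_payoff (w, wait D v w)).
  have mFT : @measurable _ (TG * R)%type (F v `*` [set: R]) by exact: measurableX.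
  have mw : @measurable_fun _ _ T (TG * R)%type (F v) (fun w => (w, wait D v w)).
    apply: (@measurable_funS _ _ _ _ setT) => //.
    apply/measurable_fun_pairP; split; last exact: (measurable_wait M v).
    by move=> _ A mA; rewrite setTI; exact: sG.
  by apply: (measurable_comp mFT _ mpay mw) => _ [w Fw <-].
have mexp : @measurable_fun _ _ TG _ (F v)
    (fun w => expR (- (c w * (lambda - birth D v w)))).
  apply: measurableT_comp => //; apply: measurableT_comp => //.
  apply: measurable_funM => //; apply: measurable_funB => //; exact: measurable_cst.
rewrite (ge0_negligible_integral (sG mN) (sG mF))//; last 3 first.
- exact/measurable_EFinP.
- by move=> w Fw; rewrite lee_fin cut_payoff_ge0.
- exact: degenerate_cell_null.
rewrite [RHS](ge0_negligible_integral (sG mN) (sG mF))//; last 2 first.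
- by apply/measurable_EFinP; exact: (measurable_fun_sub sG).
- exact: degenerate_cell_null.
rewrite FN; set F' := _ `&` _.
have mF' : <<s past lambda D v >> F'.
  by rewrite /F' -FN; exact: (@measurableD _ TG).
have F'F : F' `<=` F v by move=> w [].
rewrite (integral_cond_density sG
  (p := fun z => exponential_pdf (sum_sides (cell D v z.1)) z.2)
  mF' (measurable_wait M v))//.
- apply: eq_integral => w; rewrite inE => -[Fw /= S0].
  have /andP[c0 cs] := cS Fw.
  apply: integral_first_cut => //.
  - by rewrite subr_ge0 (reached_birth lambda0 (Fr Fw)).
  - by move=> y /andP[y0 ya]; rewrite /cut_payoff/= ya y0.
  - by move=> y ya; rewrite /cut_payoff/= leNgt ya.
- apply: (@measurable_funS _ _ (TG * R)%type _ (F v `*` [set: R])) => //.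
  + exact: measurableX.
  + by move=> z [/F'F].
  + exact: (measurable_fun_exponential_pdf mF mS).
- by move=> w y [_ /= S0]; rewrite exponential_pdf_ge0// ltW.
- by move=> H A mH HF mA; exact: (wait_law M mH (fun w Hw => Fr (F'F w (HF w Hw))) mA).
- apply: (@measurable_funS _ _ (TG * R)%type _ (F v `*` [set: R])) => //.
  + exact: measurableX.
  + by move=> z [/F'F].
- by move=> w y /F'F Fw; exact: cut_payoff_ge0.
Qed.
End wait.

Let beta := sum_sides B.

(** The integrand is the conditional probability, given the past of [v], that no
later cut goes through [B]. *)
Definition weight v : \bar R :=
  (\int[P]_(w in F v) (expR (- (beta * (lambda - birth D v w))))%:E)%E.

Definition tracked_leaf v : set T := is_leaf lambda D v `&` tracked D B v.

Let sides v w : F v w -> 0 <= beta <= sum_sides (cell D v w).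
Proof.
move=> [_ t]; have [sB _] := tracked_box t; rewrite sum_sides_sub// andbT.
by apply: sumr_ge0 => j _; rewrite subr_ge0 B0.
Qed.

Lemma measurable_reached_tracked v : measurable (F v).
Proof. by apply: measurable_tracked => u _ _; exact: (draws_measurable M). Qed.

Lemma measurable_tracked_leaf v : measurable (tracked_leaf v).
Proof.
have [mr mb _ _] := measurable_state (ancestors_measurableT M (v := v)).
rewrite (_ : tracked_leaf v = F v `&`
   (reached lambda D v `&` (fun w => birth D v w + wait D v w) @^-1` `]lambda, +oo[)).
  apply: measurableI; first exact: measurable_reached_tracked.
  apply: measurable_funD => //; apply: measurable_funTS; exact: (measurable_wait M).
apply/seteqP; split => w; rewrite /= in_itv/= andbT.
  by move=> [[? ?] ?].
by move=> [[? ?] [? ?]].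
Qed.

Let mts v : measurable (tracked_split lambda D B v).
Proof.
by apply: (sigma_past_wait M (v := v)); exact: measurable_tracked_split.
Qed.

(** The payoff [cut_payoff] splits into the event that [v] is a leaf and the two
events that [B] falls into a child; on the latter the gaps of the two children
add up to [sum_sides (cell D v w) - beta]. *)
Lemma weight_rec v :
  (weight v = P (tracked_leaf v) + (weight (false :: v) + weight (true :: v)))%E.
Proof.
have mbeta : @measurable_fun _ _ (g_sigma_algebraType (past lambda D v)) _
    (F v) (cst beta).
  exact: measurable_cst.
rewrite /weight -(integral_cut_payoff mbeta (@sides v)).
pose phi w := expR (- (beta * (lambda - (birth D v w + wait D v w)))).
have mphi G : past lambda D v `|` wait_events lambda D v `<=` G ->
    @measurable_fun _ _ (g_sigma_algebraType G) _ (tracked_split lambda D B v) phi.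
  move=> vG; have pm : @ancestors_measurable R d _ (g_sigma_algebraType G) lambda D v.
    by apply: ancestors_measurable_past => A ?; apply: vG; left.
  have [mr mb _ _] := measurable_state pm.
  have mw : @measurable_fun _ _ (g_sigma_algebraType G) _
      (reached lambda D v) (wait D v).
    by move=> _ A mA; apply: sub_sigma_algebra; apply: vG; right; exists A.
  apply: (measurable_funS mr); first by move=> w [[[]]].
  apply: measurableT_comp => //; apply: measurableT_comp => //.
  apply: measurable_funM => //; apply: measurable_funB => //.
  exact: measurable_funD.
pose g b w := phi w * ((\sum_j gap B b (cell D v w) j) / sum_sides (cell D v w)).
have ch b : weight (b :: v) = (\int[P]_(w in tracked_split lambda D B v) (g b w)%:E)%E.
  by apply: (integral_child M B0) => [|w _]; [exact: mphi|exact: expR_ge0].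
rewrite -/(weight (false :: v)) -/(weight (true :: v)) !ch.
have pmT := ancestors_measurableT M (v := v).
have tsr : tracked_split lambda D B v `<=` reached lambda D v by move=> w [[[]]].
have mg b : measurable_fun (tracked_split lambda D B v) (g b).
  have [mr _ ml mh] := measurable_state pmT.
  apply: measurable_funM.
    apply: (measurable_fun_sub (sigma_past_wait M (v := v))); last exact: mphi.
    exact: measurable_tracked_split.
  apply: measurable_fun_div; last exact: (measurable_sum_sides pmT).
  apply: measurable_sum => j; apply: (measurable_funS mr tsr).
  by rewrite /gap; case: (b); apply: measurable_funB => //; exact: measurable_cst.
have gapE w : \sum_j gap B false (cell D v w) j + \sum_j gap B true (cell D v w) j =
    sum_sides (cell D v w) - beta.
  rewrite -big_split /= /beta /sum_sides -sumrB; apply: eq_bigr => j _.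
  by rewrite /side; ring.
have g0 b w : tracked_split lambda D B v w -> 0 <= g b w.
  move=> [[[rv _] tv] _]; have [sB _] := tracked_box tv.
  have /andP[b0 bs] := sides (conj rv tv).
  apply: mulr_ge0; first exact: expR_ge0.
  apply: divr_ge0; last exact: le_trans b0 bs.
  apply: sumr_ge0 => j _; have [? ?] := sB j.
  by rewrite /gap; case: (b); rewrite subr_ge0.
have mL := measurable_tracked_leaf v.
rewrite -ge0_integralD//; last 4 first.
- by move=> w tw; rewrite lee_fin g0.
- exact/measurable_EFinP.
- by move=> w tw; rewrite lee_fin g0.
- exact/measurable_EFinP.
rewrite -[X in P X]setIT -integral_indic//.
rewrite [LHS]integral_mkcond [X in (_ + X)%E]integral_mkcond.
rewrite -ge0_integralD//; last 3 first.
- by apply/measurable_EFinP; exact: measurable_indic.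
- by move=> w _; apply: erestrict_ge0 => u tu; rewrite adde_ge0// lee_fin g0.
- apply/(measurable_restrictT _ _).1 => //.
  by apply: emeasurable_funD; exact/measurable_EFinP.
apply: eq_integral => w _; rewrite !patchE indicE.
have [Fw|nFw] := pselect (F v w); last first.
  rewrite memNset// memNset ?memNset// ?adde0//.
    by move=> [[[? _] ?] _]; apply: nFw; split.
  by move=> [[? _] ?]; apply: nFw; split.
have [rw tw] := Fw.
rewrite mem_set// /cut_payoff/= lerBrDl.
have [bw|bw] := leP (birth D v w + wait D v w) lambda; last first.
  rewrite mem_set; last by split.
  rewrite memNset ?adde0// => -[[[_ /= h] _] _].
  by move: bw; rewrite ltNge h.
rewrite memNset ?add0e; last by move=> [[_ /= h] _]; move: bw; rewrite leNgt h.
have [w0|w0] := leP 0 (wait D v w); last first.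
  by rewrite memNset// => -[_ /=]; rewrite leNgt w0.
rewrite mem_set; last by split => //; split => //; split.
rewrite -EFinD; congr EFin.
by rewrite /g -mulrDr -mulrDl gapE [RHS]mulrC /phi opprD addrA.
Qed.

(** A cell in the unit cube is cut at rate at most [d], during a time at most
[lambda]. *)
Lemma tracked_leaf_ge v :
  ((expR (- (d%:R * lambda)))%:E * weight v <= P (tracked_leaf v))%E.
Proof.
pose S w := sum_sides (cell D v w).
have pm := ancestors_measurable_past (@subset_refl _ (past lambda D v)).
have mS : @measurable_fun _ _ (g_sigma_algebraType (past lambda D v)) _ (F v) S.
  by apply: (measurable_sum_sides pm) => w [].
have cS w : F v w -> 0 <= S w <= S w.
  by move=> /sides /andP[b0 bs]; rewrite lexx andbT (le_trans b0 bs).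
have -> : P (tracked_leaf v) =
    (\int[P]_(w in F v) (cut_payoff v S (w, wait D v w))%:E)%E.
  rewrite -[X in P X]setIT -integral_indic//; last exact: measurable_tracked_leaf.
  rewrite [RHS]integral_mkcond; apply: eq_integral => w _; rewrite !patchE indicE.
  have [Fw|nFw] := pselect (F v w); last first.
    rewrite [w \in F v]memNset// memNset//.
    by move=> [[? _] ?]; apply: nFw; split.
  have [rw tw] := Fw.
  rewrite [w \in F v]mem_set// /cut_payoff/= lerBrDl.
  have [bw|bw] := leP (birth D v w + wait D v w) lambda; last by rewrite mem_set.
  rewrite memNset; last by move=> [[_ /= h] _]; move: bw; rewrite leNgt h.
  by rewrite subrr !mul0r; case: ifP.
rewrite integral_cut_payoff//.
have mb : measurable_fun (F v) (birth D v).
  have [mr mb _ _] := measurable_state (ancestors_measurableT M (v := v)).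
  by apply: (measurable_funS mr) => // w [].
have mST : measurable_fun (F v) S.
  apply: (measurable_fun_sub (sigma_past M (v := v))) => //.
  exact: measurable_tracked pm.
have mexp (c : T -> R) : measurable_fun (F v) c ->
    measurable_fun (F v) (fun w => (expR (- (c w * (lambda - birth D v w))))%:E).
  move=> mc; apply/measurable_EFinP; apply: measurableT_comp => //.
  apply: measurableT_comp => //; apply: measurable_funM => //.
  by apply: measurable_funB => //; exact: measurable_cst.
rewrite /weight -ge0_integralZl_EFin ?expR_ge0//; last 2 first.
- exact: measurable_reached_tracked.
- by apply: (mexp (cst beta)).
apply: ge0_le_integral => //.
- exact: measurable_reached_tracked.
- by apply: measurable_funeM; apply: (mexp (cst beta)).
- exact: mexp.
move=> w [rw tw]; rewrite -EFinM lee_fin -expRD ler_expR.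
have [sB s1] := tracked_box tw.
have t0 := tracked_birth_ge0 tw.
have tl := reached_birth lambda0 rw.
have Sd : S w <= d%:R by exact: sum_sides_le.
have b0 : 0 <= beta by have /andP[] := sides (conj rw tw).
have S0 : 0 <= S w by rewrite (le_trans b0)//; have /andP[] := sides (conj rw tw).
by nra.
Qed.

End step.

(** * The void probability *)

Section void.
Context (R : realType) (d : nat) disp (T : measurableType disp)
  (P : probability T R) (lambda : R) (D : draws R d T).
Hypothesis M : pruned_Mondrian P lambda D.
Hypothesis lambda0 : 0 <= lambda.
Implicit Types (x : 'rV[R]_d) (v : node).

Definition tie (x : 'rV[R]_d) (v : node) : set T :=
  is_split lambda D v `&` [set w | place D v w = x 0 (axis D v w)].

Lemma tieE x v : tie x v = \big[setU/set0]_(j <- enum 'I_d)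
  ((is_split lambda D v `&` axis D v @^-1` [set j]) `&` place D v @^-1` [set x 0 j]).
Proof.
rewrite -bigcup_seq; apply/seteqP; split => w /=.
  by move=> [sv pv]; exists (axis D v w) => //=; rewrite mem_enum.
by move=> [j _] [[sv aj] pv]; split => //=; rewrite aj.
Qed.

Lemma measurable_axis_split v j :
  <<s past lambda D v `|` wait_events lambda D v `|` axis_events lambda D v >>
    (is_split lambda D v `&` axis D v @^-1` [set j]).
Proof. by apply: sub_sigma_algebra; right; exists j. Qed.

Lemma tie_axis_null x v j :
  P ((is_split lambda D v `&` axis D v @^-1` [set j])
       `&` place D v @^-1` [set x 0 j]) = 0%E.
Proof.
rewrite [LHS](place_law M (@measurable_axis_split v j))//.
by apply: integral0_eq => w _; rewrite integral_set1.
Qed.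

Lemma measurable_tie_axis x v j :
  measurable ((is_split lambda D v `&` axis D v @^-1` [set j])
                `&` place D v @^-1` [set x 0 j]).
Proof.
apply: measurableI.
  by apply: (sigma_past_wait_axis M (v := v)); exact: measurable_axis_split.
by rewrite -[X in measurable X]setTI; exact: (measurable_place M).
Qed.

Lemma tie_negligible x v : P.-negligible (tie x v).
Proof.
rewrite tieE; elim/big_ind : _ => //; first exact: negligible_set0.
  by move=> A B; exact: negligibleU.
move=> j _; apply/negligibleP; first exact: measurable_tie_axis.
exact: tie_axis_null.
Qed.

Variable B : box R d.
Hypothesis B0 : forall j, lo B 0 j <= hi B 0 j.

Notation F v := (reached lambda D v `&` tracked D B v).
Let leaf := tracked_leaf lambda D B.

Fixpoint covered (n : nat) (v : node) : set T :=
  leaf v `|` (if n is k.+1 then covered k (false :: v) `|` covered k (true :: v)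
              else set0).

Lemma measurable_covered n v : measurable (covered n v).
Proof.
have ml u : measurable (leaf u) by exact: (measurable_tracked_leaf M).
elim: n v => [|n ih] v /=; first by rewrite setU0.
by apply: measurableU => //; exact: measurableU.
Qed.

Lemma covered_F n v : covered n v `<=` F v.
Proof.
have lF u : leaf u `<=` F u by move=> w [[? _] ?].
elim: n v => [|n ih] v /=; first by rewrite setU0; exact: lF.
by move=> w [/lF//|[] /ih[[? _] [? _]]].
Qed.

Lemma coveredP n v w : covered n v w -> exists u, leaf u w.
Proof.
elim: n v => [|n ih] v /=; first by move=> [h|//]; exists v.
by move=> [?|[/ih|/ih]//]; exists v.
Qed.

Lemma leaf_covered s u w : leaf (s ++ u) w -> covered (size s) u w.
Proof.
elim/last_ind: s u => [|s b ih] u /=; first by left.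
by rewrite cat_rcons size_rcons => /ih; case: b => ?; right; [right|left].
Qed.

Lemma covered_sub n v : covered n v `<=` covered n.+1 v.
Proof.
elim: n v => [|n ih] v w; first by move=> [?|//]; left.
by move=> [?|[/ih ?|/ih ?]]; [left|right; left|right; right].
Qed.

Let m v : \bar R := weight P lambda D B v.

Let m_ge0 v : (0 <= m v)%E.
Proof. by apply: integral_ge0 => w _; rewrite lee_fin expR_ge0. Qed.

Lemma weight_fin v : m v \is a fin_num.
Proof.
have := tracked_leaf_ge M lambda0 B0 v; have := m_ge0 v; rewrite /m.
case: (weight _ _ _ _ _) => // _.
rewrite gt0_muley ?lte_fin ?expR_gt0// leye_eq => /eqP h.
by have := probability_le1 P (measurable_tracked_leaf M B v); rewrite h.
Qed.

Lemma covered_le n v : (P (covered n v) <= m v)%E.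
Proof.
elim: n v => [|n ih] v.
  rewrite [covered 0 v]setU0 [m v](weight_rec M lambda0 B0) leeDl//.
  by apply: adde_ge0; exact: m_ge0.
rewrite [m v](weight_rec M lambda0 B0) /=.
have ml : measurable (leaf v) by exact: (measurable_tracked_leaf M).
have mc b : measurable (covered n (b :: v)) by exact: measurable_covered.
apply: (le_trans (measureU2 P ml (measurableU _ _ (mc false) (mc true)))).
apply: leeD => //; apply: (le_trans (measureU2 P (mc false) (mc true))).
by apply: leeD; exact: ih.
Qed.

Lemma children_overlap n x v : in_box x B ->
  covered n (false :: v) `&` covered n (true :: v) `<=` tie x v.
Proof.
move=> xB w [/covered_F[[rv sv] tf] /covered_F[_ tt]]; split=> //=.
have [/(_ (axis D v w))[_ +] _] := tracked_box tf.
have [/(_ (axis D v w))[+ _] _] := tracked_box tt.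
rewrite /= !mxE eqxx => pl ph; have /andP[lx xh] := xB (axis D v w).
by apply/le_anti; rewrite (le_trans pl lx) (le_trans xh ph).
Qed.

(** By [tracked_leaf_ge], at most the fraction [1 - expR (- (d * lambda))] of the
weight is passed on to the next generation. The point [x] of [B] serves to make the events
of the two children disjoint up to the null event [tie x v]. *)
Lemma covered_ge n v x : in_box x B ->
  ((1 - (1 - expR (- (d%:R * lambda))) ^+ n.+1)%:E * m v <= P (covered n v))%E.
Proof.
move=> xB; elim: n v => [|n ih] v.
  rewrite [covered 0 v]setU0 expr1 subKr; exact: (tracked_leaf_ge M).
have ml : measurable (leaf v) by exact: (measurable_tracked_leaf M).
have mc := measurable_covered.
have -> : P (covered n.+1 v) =
    (P (leaf v) + (P (covered n (false :: v)) + P (covered n (true :: v))))%E.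
  rewrite /= measureU//; last 2 first.
  - by apply: measurableU.
  - rewrite -subset0 => w [[[_ /= h] _] [|] /covered_F[[_ /= h'] _]];
    by move: h; rewrite ltNge h'.
  congr (_ + _)%E.
  have fin2 : (P (covered n (true :: v)) < +oo)%E.
    by rewrite (le_lt_trans (probability_le1 _ _))// ltry.
  rewrite [LHS](measureUfinr (mc n (false :: v)) (mc n (true :: v)) fin2).
  have := negligibleS (@children_overlap n x v xB) (tie_negligible x v).
  have mI := measurableI _ _ (mc n (false :: v)) (mc n (true :: v)).
  by move/(negligibleP _ mI) => h; rewrite [X in (_ - X)%E]h sube0.
have Pfin A : measurable A -> (fine (P A))%:E = P A.
  by move=> mA; rewrite fineK// fin_num_measure.
have := ih (false :: v); have := ih (true :: v).
have := tracked_leaf_ge M lambda0 B0 v; rewrite -/leaf.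
have := weight_rec M lambda0 B0 v; rewrite -/leaf -/(m _) -/(m _) -/(m _).
rewrite -(Pfin (leaf v))//.
rewrite -(Pfin (covered n (false :: v)))// -(Pfin (covered n (true :: v)))//.
rewrite -(fineK (weight_fin v)).
rewrite -(fineK (weight_fin (false :: v))) -(fineK (weight_fin (true :: v))).
rewrite -!EFinM -!EFinD !lee_fin => -[] mE.
set e := expR _; set a := (1 - e) ^+ n.+1.
have a0 : 0 <= a.
  by rewrite exprn_ge0// subr_ge0 -expR0 ler_expR oppr_le0 mulr_ge0.
move=> h1 h2 h3; have h4 := ler_wpM2l a0 h1.
have aE : a * fine (m v) =
    a * (fine (P (leaf v)) + (fine (m (false :: v)) + fine (m (true :: v)))).
  by rewrite {1}mE.
rewrite exprS -/a; lra.
Qed.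

Definition void_event : set T := \bigcup_v leaf v.

Lemma void_eventE : void_event = \bigcup_n covered n [::].
Proof.
apply/seteqP; split => w.
  by move=> [v _ lv]; exists (size v) => //; apply: leaf_covered; rewrite cats0.
by move=> [n _ /coveredP[u lu]]; exists u.
Qed.

Lemma measurable_void : measurable void_event.
Proof.
by rewrite void_eventE; apply: bigcupT_measurable => n; exact: measurable_covered.
Qed.

Lemma void_le_weight : (P void_event <= m [::])%E.
Proof.
rewrite void_eventE.
have nd : nondecreasing_seq (covered ^~ [::]).
  by apply/nondecreasing_seqP => n; apply/subsetPset; exact: covered_sub.
have mc n : measurable (covered n [::]) by exact: measurable_covered.
have cv := nondecreasing_cvg_mu (mu := P) mc (bigcupT_measurable _ mc) nd.
rewrite -(cvg_lim _ cv)//; apply: lime_le; first by apply/cvg_ex; eexists; exact: cv.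
by apply: nearW => n; exact: covered_le.
Qed.

Lemma void_ge_weight x : in_box x B -> (m [::] <= P void_event)%E.
Proof.
move=> xB.
have H n : ((1 - (1 - expR (- (d%:R * lambda))) ^+ n.+1)%:E * m [::] <= P void_event)%E.
  apply: (le_trans (covered_ge _ _ xB)); apply: le_measure; rewrite ?inE.
  - exact: measurable_covered.
  - exact: measurable_void.
  - by rewrite void_eventE => w ?; exists n.
have mE : (fine (m [::]))%:E = m [::] by rewrite fineK// weight_fin.
have pE : (fine (P void_event))%:E = P void_event.
  by rewrite fineK// fin_num_measure//; exact: measurable_void.
rewrite -mE -pE lee_fin.
set q := 1 - expR _ in H.
have q1 : `|q| < 1.
  have e1 : expR (- (d%:R * lambda)) <= 1.
    by rewrite -expR0 ler_expR oppr_le0 mulr_ge0.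
  by rewrite ger0_norm /q ?subr_ge0// ltrBlDr ltrDl expR_gt0.
have C : (1 - q ^+ n.+1) * fine (m [::]) @[n --> \oo] --> fine (m [::]).
  rewrite -[X in _ --> X]mul1r; apply: cvgMl.
  rewrite -[X in _ --> X]subr0; apply: cvgB; first exact: cvg_cst.
  by have := cvg_expr q1; rewrite -cvg_shiftS.
apply: (cvgr_to_le C).
by apply: nearW => n; rewrite -lee_fin EFinM mE pE.
Qed.

Lemma weight_root : m [::] =
  if `[< box_sub B (unit_box R d) >] then (expR (- (lambda * sum_sides B)))%:E else 0%E.
Proof.
rewrite /m /weight/= setTI; case: asboolP => h.
  rewrite (_ : [set _ | _] = setT); last by apply/seteqP; split => w.
  under eq_integral do rewrite subr0 mulrC.
  by rewrite integral_cst//= probability_setT mule1.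
by rewrite (_ : [set _ | _] = set0) ?integral_set0//; apply/seteqP; split => w.
Qed.

Lemma void_le : (P void_event <= (expR (- (lambda * sum_sides B)))%:E)%E.
Proof.
by rewrite (le_trans void_le_weight)// weight_root; case: ifP => // _.
Qed.

Lemma void_eq0 : ~ box_sub B (unit_box R d) -> P void_event = 0%E.
Proof.
move=> h; apply/eqP; rewrite -measure_le0 (le_trans void_le_weight)//.
by rewrite weight_root; case: asboolP.
Qed.

Lemma void_ge x : in_box x B -> box_sub B (unit_box R d) ->
  ((expR (- (lambda * sum_sides B)))%:E <= P void_event)%E.
Proof.
by move=> xB h; rewrite (le_trans _ (void_ge_weight xB))// weight_root; case: asboolP.
Qed.

End void.

(** * Uniqueness of the leaf containing a point *)

Lemma negligible_bigcup_count d (T : measurableType d) (R : realType)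
    (mu : {measure set T -> \bar R}) (I : countType) (A : I -> set T) :
  (forall i, mu.-negligible (A i)) -> mu.-negligible (\bigcup_i A i).
Proof.
move=> A0; apply: (@negligibleS _ _ _ _ (\bigcup_n (oapp A set0 (unpickle n)))).
  by move=> w [i _ Aiw]; exists (pickle i) => //; rewrite pickleK.
apply: negligible_bigcup => n; case: unpickle => [i|] /=; first exact: A0.
exact: negligible_set0.
Qed.

Section geometry.
Context (R : realType) (d : nat).
Hypothesis d0 : (0 < d)%N.

Lemma le_inf_range (c : R) (g : 'I_d -> R) :
  c <= inf (range g) <-> forall j, c <= g j.
Proof.
split=> [cg j|cg].
  apply: (le_trans cg); apply: ge_inf; last by exists j.
  exists (- \sum_i `|g i|) => _ [i _ <-].
  rewrite lerNl (le_trans (ler_norm _))// normrN (bigD1 i)//= lerDl.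
  by apply: sumr_ge0.
by apply: lb_le_inf; [exists (g (Ordinal d0)), (Ordinal d0)|move=> _ [j _ <-]].
Qed.

Lemma measurable_inf_range disp (T : measurableType disp) (F : set T)
    (f : T -> 'I_d -> R) : measurable F ->
  (forall j, measurable_fun F (f ^~ j)) ->
  measurable_fun F (fun w => inf (range (f w))).
Proof.
move=> mF mf; apply: (measurability (@RGenCInfty.G R)) => [|_ [_ [c ->] <-]].
  exact: RGenCInfty.measurableE.
rewrite (_ : _ `&` _ = F `&` [set w | forall j, c <= f w j]).
  apply: measurable_forall_ord => // j; apply: measurable_le_fun => //.
by apply/seteqP; split => w /=; rewrite in_itv/= andbT => -[? /le_inf_range].
Qed.

Lemma measurable_sup_range disp (T : measurableType disp) (F : set T)
    (f : T -> 'I_d -> R) : measurable F ->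
  (forall j, measurable_fun F (f ^~ j)) ->
  measurable_fun F (fun w => sup (range (f w))).
Proof.
move=> mF mf.
rewrite (_ : (fun w => _) = (fun w => - inf (range (fun j => - f w j)))).
  apply: measurableT_comp => //; apply: measurable_inf_range => // j.
  exact: measurableT_comp.
apply/funext => w; rewrite /inf opprK; congr (sup _).
apply/seteqP; split => [_ [j _ <-]|_ [_ [j _ <-] <-]] /=.
  by exists (- f w j); [exists j|rewrite opprK].
by exists j => //; rewrite opprK.
Qed.
End geometry.

Section uniqueness.
Context (R : realType) (d : nat) disp (T : measurableType disp)
  (P : probability T R) (lambda : R) (D : draws R d T).
Hypothesis M : pruned_Mondrian P lambda D.

(** Cut locations outside the side being cut. They are harmless almost surely, but
they would make a child larger than its parent. *)
Definition outside v : set T := is_split lambda D v `&`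
  [set w | ~~ (lo (cell D v w) 0 (axis D v w) <= place D v w
               <= hi (cell D v w) 0 (axis D v w))].

(** A rational number separates the location from the end of the side that it
overshoots. With this number fixed, the end is compared with a constant, which is
an event of the past, and the location lies in a fixed half-line where the
density vanishes. *)
Lemma outside_negligible v : P.-negligible (outside v).
Proof.
set G := past lambda D v `|` wait_events lambda D v `|` axis_events lambda D v.
have sG : <<s G >> `<=` @measurable _ T by exact: (sigma_past_wait_axis M).
pose A (k : 'I_d * (rat * bool)) : set T := let: (j, (q, b)) := k in
  (is_split lambda D v `&` axis D v @^-1` [set j] `&`
   [set w | if b then hi (cell D v w) 0 j <= ratr q
            else ratr q <= lo (cell D v w) 0 j]) `&`
  place D v @^-1` (if b then `]ratr q, +oo[ else `]-oo, ratr q[)%classic.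
apply: (@negligibleS _ _ _ _ (\bigcup_k A k)).
  move=> w [sv /=]; rewrite negb_and -!ltNge => /orP[lt|lt];
  have [q] := rat_in_itvoo lt; rewrite in_itv/= => /andP[q1 q2].
    exists (axis D v w, (q, false)) => //.
    by split; [split => //=; exact: ltW|rewrite /= in_itv/=].
  exists (axis D v w, (q, true)) => //.
  by split; [split => //=; exact: ltW|rewrite /= in_itv/= andbT].
apply: negligible_bigcup_count => -[j [q b]].
have mI : measurable (if b then `]ratr q, +oo[ else `]-oo, (ratr q : R)[)%classic.
  by case: b; exact: measurable_itv.
have pm : @ancestors_measurable R d _ (g_sigma_algebraType G) lambda D v.
  by apply: ancestors_measurable_past => B ?; left; left.
have mF : <<s G >> (is_split lambda D v `&` axis D v @^-1` [set j] `&`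
   [set w | if b then hi (cell D v w) 0 j <= ratr q
            else ratr q <= lo (cell D v w) 0 j]).
  have [mr _ ml mh] := measurable_state pm.
  have ms := @measurable_axis_split _ _ _ _ lambda D v j.
  set S := _ `&` axis D v @^-1` _ in ms *.
  have Sr : S `<=` reached lambda D v by move=> w [[]].
  case: (b); apply: (@measurable_le_fun R _ (g_sigma_algebraType G)) => //;
    exact: (measurable_funS mr).
apply/negligibleP.
  apply: measurableI; first exact: sG.
  by rewrite -[X in measurable X]setTI; exact: (measurable_place M).
rewrite [LHS](place_law M mF)//; last by move=> w [[]].
apply: integral0_eq => w [[sv /= aj] hq]; apply: integral0_eq => s.
rewrite /uniform_pdf aj; case: {mI mF} b hq => /= hq; rewrite in_itv/= ?andbT => sq.
  by rewrite [s <= _]leNgt (le_lt_trans hq sq) andbF.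
by rewrite [_ <= s]leNgt (lt_le_trans sq hq).
Qed.

Lemma cell_nested s u w : reached lambda D (s ++ u) w ->
  (forall v, ~ outside v w) ->
  reached lambda D u w /\ box_sub (cell D (s ++ u) w) (cell D u w).
Proof.
move=> + out; elim: s => [|b s ih] /=; first by move=> ?; split.
move=> [rs ss]; have [ru sub] := ih rs; split => // k.
have /andP[l h] : lo (cell D (s ++ u) w) 0 (axis D (s ++ u) w) <= place D (s ++ u) w
    <= hi (cell D (s ++ u) w) 0 (axis D (s ++ u) w).
  by apply: contrapT => /negP h; apply: (out (s ++ u)); split.
have [sl sh] := sub k.
case: b; rewrite /= ?mxE; split => //; case: eqP => // ->.
- by rewrite (le_trans _ l)//; have [] := sub (axis D (s ++ u) w).
- by rewrite (le_trans h)//; have [] := sub (axis D (s ++ u) w).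
Qed.

Lemma in_box_sub x (A C : box R d) : box_sub A C -> in_box x A -> in_box x C.
Proof.
move=> AC xA j; have [l h] := AC j; have /andP[? ?] := xA j.
by rewrite (le_trans l)//= (le_trans _ h).
Qed.

(** Take two leaves whose cells contain [x], and the last common node [c] on the way
to them. Cells being nested, both children of [c] contain [x], so [c] was cut
exactly at [x]. *)
Lemma leaf_unique x u v w :
  (forall c, ~ outside c w) -> (forall c, ~ tie lambda D x c w) ->
  is_leaf lambda D u w -> in_box x (cell D u w) ->
  is_leaf lambda D v w -> in_box x (cell D v w) -> u = v.
Proof.
move=> out nt [ru lu] xu [rv lv] xv.
have split_child b c s : reached lambda D (s ++ b :: c) w -> is_split lambda D c w.
  by move=> /cell_nested -/(_ out)[].
have xchild b c s : reached lambda D (s ++ b :: c) w ->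
    in_box x (cell D (s ++ b :: c) w) -> in_box x (cell D (b :: c) w).
  by move=> /cell_nested -/(_ out)[_ /in_box_sub]; apply.
suff H s t c : u = s ++ c -> v = t ++ c -> u = v by apply: (H u v [::]); rewrite cats0.
elim/last_ind: s t c => [|s b ih] t c uE vE.
  case/lastP: t vE => [|t b] vE; first by rewrite uE vE.
  move: vE; rewrite cat_rcons => vE; move: rv; rewrite vE => /split_child[_ /=].
  by move: lu; rewrite uE /= ltNge => /negbTE ->.
move: uE; rewrite cat_rcons => uE.
case/lastP: t vE => [|t b'] vE.
  move: ru; rewrite uE => /split_child[_ /=].
  by move: lv; rewrite vE /= ltNge => /negbTE ->.
move: vE; rewrite cat_rcons => vE.
have [bb|bb] := eqVneq b b'; first by rewrite -bb in vE; exact: ih uE vE.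
rewrite uE in ru xu; rewrite vE in rv xv.
exfalso; apply: (nt c); split; first exact: split_child ru.
have hu := xchild _ _ _ ru xu (axis D c w); have hv := xchild _ _ _ rv xv (axis D c w).
move: hu hv; rewrite /=; case: b b' bb {uE vE ru rv xu xv ih} => -[]//= _;
  rewrite !mxE eqxx;
  by move=> /andP[h1 h2] /andP[h3 h4]; apply/le_anti; rewrite ?h1 ?h2 ?h3 ?h4.
Qed.

Lemma exceptional_negligible x :
  P.-negligible (\bigcup_c (outside c `|` tie lambda D x c)).
Proof.
apply: negligible_bigcup_count => c.
by apply: negligibleU; [exact: outside_negligible|exact: (tie_negligible M)].
Qed.
End uniqueness.

(** * The aspect ratio of the cell of a point *)

Section target.
Context (R : realType) (d : nat) disp (T : measurableType disp)
  (P : probability T R) (lambda : R) (D : draws R d T).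
Hypothesis M : pruned_Mondrian P lambda D.
Hypothesis d0 : (0 < d)%N.

Lemma measurable_aspect_event (x : 'rV[R]_d) (K : R) :
  measurable [set w | (exists V, cells_at lambda D x w V) /\
      forall V, cells_at lambda D x w V -> h_plus V / h_minus V <= K].
Proof.
pose A v := is_leaf lambda D v `&` [set w | in_box x (cell D v w)].
pose Q v := A v `&` [set w | h_plus (cell D v w) / h_minus (cell D v w) <= K].
have mA v : measurable (A v).
  have pm := ancestors_measurableT M (v := v).
  have [mr mb _ _] := measurable_state pm.
  have [mx' _] := measurable_box_sub (Box x x) pm.
  rewrite (_ : A v = (reached lambda D v `&`
        (fun w => birth D v w + wait D v w) @^-1` `]lambda, +oo[) `&`
      (reached lambda D v `&` [set w | box_sub (Box x x) (cell D v w)])).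
    apply: measurableI => //.
    by apply: measurable_funD => //; apply: measurable_funTS; exact: (measurable_wait M).
  apply/seteqP; split => w /=; rewrite in_itv/= andbT.
    move=> [[rv bw] xw]; split => //; split => // j /=.
    by have /andP[] := xw j.
  by move=> [[rv bw] [_ xw]]; split => // j; have [/= -> ->] := xw j.
have mQ v : measurable (Q v).
  have pm := ancestors_measurableT M (v := v).
  have Ar : A v `<=` reached lambda D v by move=> w [[]].
  have ms j : measurable_fun (A v) (fun w => side (cell D v w) j).
    exact: (measurable_side pm).
  apply: measurable_le_fun => //.
  apply: measurable_fun_div.
    exact: (measurable_sup_range d0 (f := fun w => side (cell D v w))).
  exact: (measurable_inf_range d0 (f := fun w => side (cell D v w))).
rewrite (_ : [set w | _] = (\bigcup_v A v) `&` ~` (\bigcup_v (A v `\` Q v))).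
  apply: measurableI.
    by apply: countable_bigcupT_measurable => //; exact: countableP.
  apply: measurableC; apply: countable_bigcupT_measurable; first exact: countableP.
  by move=> v; exact: measurableD.
apply/seteqP; split => w /=.
  move=> [[V [[v lv VE] xV]] h]; split.
    by exists v => //; split => //=; rewrite -VE.
  move=> [u _ [[lu xu] nQ]]; apply: nQ; split; first by split.
  by apply: h; split => //; exists u.
move=> [[v _ [lv xv]] nQ]; split.
  by exists (cell D v w); split => //; exists v.
move=> V [[u lu ->] xu].
by apply: contrapT => h; apply: nQ; exists u => //; split; [split|move=> []].
Qed.

Lemma measure_bigsetU_le (I : Type) (s : seq I) (A : I -> set T) :
  (forall i, measurable (A i)) ->
  (P (\big[setU/set0]_(i <- s) A i) <= \sum_(i <- s) P (A i))%E.
Proof.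
move=> mA; elim: s => [|i s ih]; first by rewrite !big_nil measure0.
rewrite !big_cons (le_trans (measureU2 _ _ _))//.
  by apply: bigsetU_measurable.
by rewrite leeD2l.
Qed.
End target.

Section numeric.
Context (R : realType) (d : nat) (delta : R).
Hypothesis d0 : (0 < d)%N.
Hypothesis delta0 : 0 < delta <= 1 - (1 - expR (-1)) ^+ d.

Let e1_ge : 2 <= expR (1 : R).
Proof. by have := expR_ge1Dx (1 : R); rewrite -(natrD _ 1 1). Qed.

Let e1 : 0 < expR (-1 : R) <= 2^-1.
Proof.
rewrite expR_gt0/= expRN lef_pV2 ?posrE ?expR_gt0//.
Qed.

Lemma delta_lt1 : 0 < delta < 1.
Proof.
have /andP[-> h] := delta0.
by rewrite (le_lt_trans h)// ltrBlDr ltrDl exprn_gt0// subr_gt0.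
Qed.

(** Bernoulli's inequality gives [delta <= d * expR (-1)]. *)
Lemma log_delta_d : 1 <= - ln (delta / d%:R).
Proof.
have /andP[p0 h] := delta0.
have dR : 0 < d%:R :> R by rewrite ltr0n.
rewrite lerNr -(expRK (-1)) ler_ln ?posrE ?expR_gt0 ?divr_gt0//.
rewrite ler_pdivrMr// (le_trans h)//.
have : forall n, 1 - n%:R * expR (-1) <= (1 - expR (-1 : R)) ^+ n.
  have /andP[e0 e2] := e1.
  elim=> [|n ih]; first by rewrite mul0r subr0 expr0.
  rewrite exprS; have q0 : 0 <= 1 - expR (-1 : R) by lra.
  apply: le_trans (ler_wpM2l q0 ih).
  rewrite -natr1; have : 0 <= n%:R :> R by []. 
  by nra.
by move=> /(_ d); lra.
Qed.

Lemma log_1delta : 0 < - ln (1 - delta) <= d%:R.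
Proof.
have /andP[p0 p1] := delta_lt1; have /andP[_ h] := delta0.
have /andP[e0 e2] := e1.
rewrite oppr_gt0 ln_lt0/=; last by apply/andP; split; lra.
rewrite lerNl -[- d%:R]expRK ler_ln ?posrE ?expR_gt0 ?subr_gt0//.
have -> : - d%:R = d%:R * (-1) :> R by rewrite mulrN1.
rewrite expRM_natl (@le_trans _ _ ((1 - expR (-1)) ^+ d))//; last by lra.
by apply: lerXn2r; rewrite ?nnegrE; lra.
Qed.

(** The two branches of the minimum in [s] decide the last conclusion. If
[s = A / (lambda * d)], then [lambda * u = 5 * L / 2], and
[expR (- (5 * L / 2)) <= expR (- L) / 2 = delta / (2 * d)] because [1 <= L]. If
[s = 1], then [u = K / 2] exceeds [1], as [5 <= K] by [log_1delta]. *)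
Lemma choice_of_scales (lambda : R) : 0 < lambda ->
  let K := 5 * d%:R * ln (delta / d%:R) / ln (1 - delta) in
  exists s u : R, [/\ 0 <= K, 0 < s <= 1 /\ lambda * (d%:R * s) <= - ln (1 - delta),
    0 < u /\ 2 * u = K * s & u <= 1 -> expR (- (lambda * u)) <= delta / (2 * d%:R)].
Proof.
move=> l0 K; have L1 := log_delta_d; have /andP[A0 Ad] := log_1delta.
have dR : 0 < d%:R :> R by rewrite ltr0n.
have /andP[p0 p1] := delta_lt1.
set L := - ln _ in L1; set A := - ln _ in A0 Ad *.
have n0 : ln (1 - delta) != 0 by rewrite -oppr_eq0 gt_eqF.
have KE : K = 5 * d%:R * L / A by rewrite /K /L /A; field.
have K5 : 5 <= K.
  by rewrite KE ler_pdivlMr//; nra.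
pose s0 := A / (lambda * d%:R); pose s := Num.min 1 s0.
have ld : 0 < lambda * d%:R by rewrite mulr_gt0.
have s00 : 0 < s0 by rewrite divr_gt0.
have s_gt0 : 0 < s by rewrite lt_min ltr01.
exists s, (K * s / 2); split.
- by rewrite (le_trans _ K5).
- split; first by rewrite s_gt0 ge_min lexx.
  by rewrite mulrA mulrC -ler_pdivlMr// ge_min lexx orbT.
- by split; [rewrite divr_gt0// mulr_gt0// (lt_le_trans _ K5)|field].
- rewrite /s; case: (leP 1 s0) => [_ h|s01 _]; first by exfalso; lra.
  have -> : lambda * (K * s0 / 2) = L + (3 / 2) * L.
    by rewrite KE /s0; field; rewrite !gt_eqF.
  have eL : expR (- L) = delta / d%:R by rewrite /L opprK lnK ?posrE ?divr_gt0.
  have -> : delta / (2 * d%:R) = delta / d%:R * 2^-1 by field; rewrite gt_eqF.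
  rewrite opprD expRD eL; apply: ler_wpM2l; first by rewrite divr_ge0// ltW.
  have /andP[_ e2] := e1; apply: le_trans e2.
  by rewrite ler_expR; lra.
Qed.
End numeric.

Section enclosure.
Context (R : realType) (d : nat) disp (T : measurableType disp)
  (P : probability T R) (lambda : R) (D : draws R d T).

(** Off the exceptional events cells are nested, so that the ancestors of [v] need
not be inspected again when [B] is replaced by another box. *)
Lemma tracked_widen (B B' : box R d) v w : (forall c, ~ outside lambda D c w) ->
  reached lambda D v w -> tracked D B v w -> box_sub B' (cell D v w) ->
  tracked D B' v w.
Proof.
move=> out; elim: v => [|b u ih] //= rv [tu [_ c1 w0]] sB'; split => //.
have [ru sub] := @cell_nested _ _ _ _ _ _ [:: b] u w rv out.
apply: ih => // j; have [l h] := sub j; have [l' h'] := sB' j.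
by rewrite (le_trans l l') (le_trans h' h).
Qed.

Definition arm (x : 'rV[R]_d) (u : R) (k : bool * 'I_d) : box R d :=
  if k.1 then Box (\row_i (if i == k.2 then x 0 i - u else x 0 i)) x
  else Box x (\row_i (if i == k.2 then x 0 i + u else x 0 i)).

Lemma sum_sides_arm x u k : sum_sides (arm x u k) = u.
Proof.
rewrite /sum_sides /side (bigD1 k.2)//= big1 ?addr0.
  by rewrite /arm; case: k.1; rewrite /= !mxE eqxx; ring.
by move=> i /negbTE ik; rewrite /arm; case: k.1; rewrite /= !mxE ik subrr.
Qed.

Lemma arm_le x u k j : 0 <= u -> lo (arm x u k) 0 j <= hi (arm x u k) 0 j.
Proof.
by move=> u0; rewrite /arm; case: k.1; rewrite /= !mxE; case: ifP => // _; lra.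
Qed.

Lemma arm_not_sub (x : 'rV[R]_d) u k : (forall j, 0 <= x 0 j <= 1) -> 1 < u ->
  ~ box_sub (arm x u k) (unit_box R d).
Proof.
move=> x01 u1 /(_ k.2); rewrite /arm; have := x01 k.2.
by case: k.1; rewrite /= !mxE eqxx; lra.
Qed.

Lemma side_lt_arms (x : 'rV[R]_d) u (A : box R d) j : in_box x A ->
  (forall k, ~ box_sub (arm x u k) A) -> side A j < 2 * u.
Proof.
move=> xA no; have xj i := andP (xA i).
have lj : x 0 j - u < lo A 0 j.
  rewrite ltNge; apply/negP => h; apply: (no (true, j)) => i.
  by rewrite /arm /= mxE; have [? ?] := xj i; split => //; case: eqP => [->|].
have hj : hi A 0 j < x 0 j + u.
  rewrite ltNge; apply/negP => h; apply: (no (false, j)) => i.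
  by rewrite /arm /= mxE; have [? ?] := xj i; split => //; case: eqP => [->|].
by rewrite /side; lra.
Qed.

(** The lower corner is the affine choice that keeps the cube of side [s] inside the
unit cube with [x] in it. *)
Definition core (x : 'rV[R]_d) (s : R) : box R d :=
  Box (\row_j (x 0 j * (1 - s))) (\row_j (x 0 j * (1 - s) + s)).

Lemma side_core x s j : side (core x s) j = s.
Proof. by rewrite /side !mxE; ring. Qed.

Lemma in_box_core (x : 'rV[R]_d) s :
  (forall j, 0 <= x 0 j <= 1) -> 0 <= s -> in_box x (core x s).
Proof. by move=> x01 s0 j; have := x01 j; rewrite !mxE; nra. Qed.

Lemma core_unit (x : 'rV[R]_d) s : (forall j, 0 <= x 0 j <= 1) -> 0 <= s <= 1 ->
  box_sub (core x s) (unit_box R d).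
Proof. by move=> x01 s0 j; have := x01 j; rewrite !mxE => ?; split; nra. Qed.

Lemma ratio_le (A : box R d) (s K : R) : (0 < d)%N -> 0 < s -> 0 <= K ->
  (forall j, s <= side A j) -> (forall j, side A j <= K * s) ->
  h_plus A / h_minus A <= K.
Proof.
move=> d0 s0 K0 sA AK.
have h1 : s <= h_minus A by apply/(le_inf_range d0).
have h2 : h_plus A <= K * s.
  by apply: ge_sup; [exists (side A (Ordinal d0)), (Ordinal d0)|move=> _ [j _ <-]].
rewrite ler_pdivrMr ?(lt_le_trans s0)// (le_trans h2)//.
exact: ler_wpM2l.
Qed.
End enclosure.

Theorem proposition27 (R : realType) (d : nat) (lambda : R) (x : 'rV[R]_d)
    (disp : measure_display) (T : measurableType disp) (P : probability T R)
    (D : draws R d T) (delta : R) :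
  (1 <= d)%N -> 0 < lambda -> (forall j, 0 <= x 0 j <= 1) ->
  pruned_Mondrian P lambda D ->
  0 < delta <= 1 - (1 - expR (-1)) ^+ d ->
  ((1 - 2 * delta)%:E <=
    P [set w | (exists V, cells_at lambda D x w V) /\
      forall V, cells_at lambda D x w V ->
        (h_plus V / h_minus V <=
          5 * d%:R * ln (delta / d%:R) / ln (1 - delta))%R])%E.
Proof.
move=> d0 l0 x01 M delta_bnd.
have [s [u [K0 [s01 ls] [u0 uE] armp]]] := choice_of_scales d0 delta_bnd l0.
set K := _ / _ in K0 uE *.
have /andP[s0 s1] := s01; have dR : 0 < d%:R :> R by rewrite ltr0n.
have xc : in_box x (core x s) by apply: in_box_core => //; exact: ltW.
have c1 : box_sub (core x s) (unit_box R d) by apply: core_unit => //; rewrite ltW.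
have c0 j : lo (core x s) 0 j <= hi (core x s) 0 j.
  by rewrite -subr_ge0 -/(side _ j) side_core ltW.
have a0 k j : lo (arm x u k) 0 j <= hi (arm x u k) 0 j by apply: arm_le; exact: ltW.
have lambda0 := ltW l0.
pose V := void_event lambda D.
have mV B : measurable (V B) by exact: (measurable_void M).
pose Z := \big[setU/set0]_(k <- enum {: bool * 'I_d}) V (arm x u k).
have mZ : measurable Z by exact: bigsetU_measurable.
have [N [mN N0 exN]] := exceptional_negligible M x.
set E := [set w | _].
have mE : measurable E by exact: (measurable_aspect_event M).
(* On this event the cell of [x] contains the core and none of the arms. *)
have VE : V (core x s) `\` (Z `|` N) `<=` E.
  move=> w [[v _ [[rv lv] tv]] nZN].
  have out c : ~ outside lambda D c w.
    by move=> h; apply: nZN; right; apply: exN; exists c => //; left.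
  have nt c : ~ tie lambda D x c w.
    by move=> h; apply: nZN; right; apply: exN; exists c => //; right.
  have [cv v1] := tracked_box tv.
  have xv := in_box_sub cv xc.
  split; first by exists (cell D v w); split => //; exists v.
  move=> _ [[v' lv' ->] xv'].
  have <- : v = v' by apply: (leaf_unique out nt _ xv lv' xv').
  apply: (ratio_le d0 s0 K0) => j.
    by rewrite -[leLHS](side_core x s j); exact: side_sub.
  rewrite -uE ltW//; apply: side_lt_arms => // k ak; apply: nZN; left.
  rewrite /Z -bigcup_seq; exists k; first by rewrite /= mem_enum.
  by exists v => //; split => //; exact: tracked_widen tv ak.
have Pc : ((1 - delta)%:E <= P (V (core x s)))%E.
  apply: le_trans (void_ge M lambda0 c0 xc c1).
  have /andP[p0 p1] := delta_lt1 delta_bnd.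
  rewrite lee_fin -[leLHS]lnK ?posrE ?subr_gt0// ler_expR lerNr.
  apply: le_trans ls; rewrite /sum_sides.
  under eq_bigr do rewrite side_core.
  by rewrite sumr_const card_ord mulr_natl.
have PZ : (P Z <= delta%:E)%E.
  rewrite (le_trans (measure_bigsetU_le _ _ _))// big_enum/=.
  have h k : (P (V (arm x u k)) <= (delta / (2 * d%:R))%:E)%E.
    have [u1|u1] := leP u 1.
      rewrite (le_trans (void_le M lambda0 (a0 k)))// sum_sides_arm lee_fin.
      exact: armp.
    rewrite [X in (X <= _)%E](void_eq0 M lambda0 (a0 k)); last exact: arm_not_sub.
    have /andP[p0 p1] := delta_lt1 delta_bnd.
    by rewrite lee_fin divr_ge0 ?mulr_ge0// ltW.
  rewrite (le_trans (lee_sum _ (fun k _ => h k)))// sumEFin lee_fin.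
  rewrite sumr_const card_prod card_bool card_ord -[leLHS]mulr_natl natrM.
  by rewrite mulrC divfK// mulf_neq0// gt_eqF.
have : (P (V (core x s)) <= P E + (P Z + P N))%E.
  apply: (@le_trans _ _ (P (E `|` (Z `|` N)))).
    apply: le_measure; rewrite ?inE//.
      by apply: measurableU => //; exact: measurableU.
    move=> w Vw; have [ZN|ZN] := pselect ((Z `|` N) w); first by right.
    by left; apply: VE.
  rewrite (le_trans (measureU2 _ _ _))//; first exact: measurableU.
  by rewrite leeD2l// measureU2.
rewrite N0 adde0 => h.
have : ((1 - delta)%:E <= P E + delta%:E)%E.
  by rewrite (le_trans Pc)// (le_trans h)// leeD2l.
rewrite -leeBlDr// -EFinB; apply: le_trans; rewrite lee_fin; lra.
Qed.
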